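(* Let $M=\mathrm{Inv}\langle A\mid R\rangle$ be an inverse monoid given by a finite presentation and let $w\in (A\cup A^{-1})^*$. If the Schützenberger graph $\mathcal S(w)$ is tree-like, then the language $$L(\mathcal A(w))=\{u\in (A\cup A^{-1})^* : u\geq w \text{ in } M\}$$ is context-free.
   Context: An inverse monoid is a monoid in which every element $s$ has a unique $s^{-1}$ with $ss^{-1}s=s$ and $s^{-1}ss^{-1}=s^{-1}$. Let $A^{-1}$ be a set of formal inverses of $A$, disjoint from $A$, and give $(A\cup A^{-1})^*$ the obvious involution. The inverse monoid $M=\mathrm{Inv}\langle A\mid R\rangle$, $R\subseteq (A\cup A^{-1})^*\times(A\cup A^{-1})^*$, is the quotient of $(A\cup A^{-1})^*$ by the congruence $\tau$ generated by $R$ and all pairs $(uu^{-1}u,u)$, $(uu^{-1}vv^{-1},vv^{-1}uu^{-1})$. The presentation is finite if $A$ and $R$ are finite. The natural partial order on $M$ is: $s\le t$ iff $s=te$ for some idempotent $e\in M$. For words $u,w$, ''$u\ge w$'' means $u\tau\ge w\tau$. The Cayley graph of $M$ with respect to $A$ has vertex set $M$ and an edge labeled $a$ from $s$ to $sa$ for all $s\in M$, $a\in A\cup A^{-1}$. The Schützenberger graph $\mathcal S(w)$ is the strongly connected component of this Cayley graph containing $w\tau$; its edges occur in inverse pairs and it is a metric space under the path metric on vertices. The Schützenberger automaton $\mathcal A(w)$ is the (possibly infinite) automaton with underlying graph $\mathcal S(w)$, initial vertex $(ww^{-1})\tau$ and terminal vertex $w\tau$; $L(\mathcal A(w))$ is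 the set of labels of paths from the initial to the terminal vertex. A connected graph with edges in inverse pairs is tree-like if it is quasi-isometric to a tree. A language is context-free if it is accepted (by terminal state) by some pushdown automaton. *)

(* Defs.v *)
From HB Require Import structures.
From mathcomp Require Import all_boot all_order all_algebra.
From mathcomp Require Import boolp classical_sets reals Rstruct.

Set Implicit Arguments.
Unset Strict Implicit.
Unset Printing Implicit Defensive.

(* [(a, false)] is the generator [a], [(a, true)] its formal inverse. *)
Notation letter A := (A * bool)%type.
Notation word A := (seq (letter A)).

Definition inv_letter (A : Type) (x : letter A) : letter A := (x.1, ~~ x.2).
Definition inv_word (A : Type) (u : word A) : word A :=
  rev (map (@inv_letter A) u).

Inductive congr_closure (T : Type) (S : seq T -> seq T -> Prop) :
    seq T -> seq T -> Prop :=
| CongrGen u v : S u v -> congr_closure S u v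
| CongrRefl u : congr_closure S u u
| CongrSym u v : congr_closure S u v -> congr_closure S v u
| CongrTrans u v t :
    congr_closure S u v -> congr_closure S v t -> congr_closure S u t
| CongrMul u u' v v' : congr_closure S u u' -> congr_closure S v v' ->
    congr_closure S (u ++ v) (u' ++ v').

Section Presentation.
Variables (A : finType) (R : seq (word A * word A)).

Inductive relator : word A -> word A -> Prop :=
| RelPres u v : (u, v) \in R -> relator u v
| RelInv u : relator (u ++ inv_word u ++ u) u
| RelComm u v : relator (u ++ inv_word u ++ v ++ inv_word v)
                        (v ++ inv_word v ++ u ++ inv_word u).

Definition tau : rel (word A) := fun u v => `[< congr_closure relator u v >].

Lemma tau_refl : reflexive tau.
Proof. by move=> u; apply/asboolP; exact: CongrRefl. Qed.

Lemma tau_sym : symmetric tau.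
Proof.
by move=> u v; apply/asboolP/asboolP => h; exact: CongrSym.
Qed.

Lemma tau_trans : transitive tau.
Proof.
by move=> v u t /asboolP uv /asboolP vt; apply/asboolP; exact: CongrTrans vt.
Qed.

Canonical tau_equiv := EquivRel tau tau_refl tau_sym tau_trans.

Definition inv_pres := {eq_quot tau_equiv}%qT.

HB.instance Definition _ := Choice.on inv_pres.

Definition cl (u : word A) : inv_pres := (\pi_{eq_quot tau_equiv} u)%qT.

Lemma cl_eqP (u v : word A) : cl u = cl v <-> congr_closure relator u v.
Proof. by split=> [/eqquotP/asboolP|h] //; apply/eqquotP/asboolP. Qed.

Definition inv_pres_rep (x : inv_pres) : word A :=
  repr (x : {eq_quot tau_equiv}%qT).

Lemma inv_pres_repK (x : inv_pres) : cl (inv_pres_rep x) = x.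
Proof. exact: reprK. Qed.

Definition inv_pres_mul (x y : inv_pres) : inv_pres :=
  cl (inv_pres_rep x ++ inv_pres_rep y).

Lemma inv_pres_mulE (u v : word A) : inv_pres_mul (cl u) (cl v) = cl (u ++ v).
Proof. by apply/cl_eqP; apply: CongrMul; apply/cl_eqP/inv_pres_repK. Qed.

Lemma inv_pres_mulA : associative inv_pres_mul.
Proof.
move=> x y z; rewrite -(inv_pres_repK x) -(inv_pres_repK y) -(inv_pres_repK z).
by rewrite !inv_pres_mulE catA.
Qed.

Lemma inv_pres_mul1 : left_id (cl [::]) inv_pres_mul.
Proof. by move=> x; rewrite -(inv_pres_repK x) inv_pres_mulE. Qed.

Lemma inv_pres_mulr1 : right_id (cl [::]) inv_pres_mul.
Proof. by move=> x; rewrite -(inv_pres_repK x) inv_pres_mulE cats0. Qed.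

HB.instance Definition _ :=
  isMonoid.Build inv_pres inv_pres_mulA inv_pres_mul1 inv_pres_mulr1.

End Presentation.

Local Open Scope group_scope.

Definition inverse_monoid (M : monoidType) : Prop :=
  forall s : M, exists! t : M, s * t * s = s /\ t * s * t = t.

Definition idempotent_elt (M : monoidType) (e : M) : Prop := e * e = e.

Definition natural_le (M : monoidType) (s t : M) : Prop :=
  exists2 e : M, idempotent_elt e & s = t * e.

(* [edge x a y] states that there is an edge labelled [a] from [x] to [y]. *)
Fixpoint lpath (L V : Type) (edge : V -> L -> V -> bool)
    (x : V) (u : seq L) (y : V) : Prop :=
  if u is a :: u' then exists2 z, edge x a z & lpath edge z u' y else x = y.

Definition lconnect (L V : Type) (edge : V -> L -> V -> bool) (x y : V) : Prop :=
  exists u, lpath edge x u y.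

Definition scc (L V : Type) (edge : V -> L -> V -> bool) (x : V) : {pred V} :=
  [pred y | `[< lconnect edge x y /\ lconnect edge y x >]].

Definition ladj (L : finType) (V : Type) (edge : V -> L -> V -> bool) : rel V :=
  fun x y => [exists a, edge x a y].

(* No finiteness is required of the set of states. *)
Record automaton (L : Type) := Automaton {
  state : Type;
  trans : state -> L -> state -> bool;
  init : state;
  final : state
}.

Arguments state {L} a.
Arguments trans {L} a.
Arguments init {L} a.
Arguments final {L} a.

Definition language (L : Type) (B : automaton L) : set (seq L) :=
  [set u | lpath (trans B) (init B) u (final B)]%classic.

Section Schutzenberger.
Variables (A : finType) (R : seq (word A * word A)).
Implicit Types (x y : inv_pres R) (u v w : word A).

Definition cayley_edge x (a : letter A) y : bool := y == x * cl R [:: a].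

Lemma cl_cat u v : cl R (u ++ v) = cl R u * cl R v.
Proof. exact/esym/inv_pres_mulE. Qed.

Lemma cayley_lpath x u y : lpath cayley_edge x u y <-> y = x * cl R u.
Proof.
elim: u x => [|a u IHu] x /=; first by rewrite [x * _]mulg1; split.
rewrite -cat1s cl_cat mulgA; split=> [[z /eqP-> /IHu]//|yE].
by exists (x * cl R [:: a]); [exact/eqP|exact/IHu].
Qed.

Definition schutz_vertex w := {x : inv_pres R | x \in scc cayley_edge (cl R w)}.

Definition schutz_edge w (x : schutz_vertex w) (a : letter A)
    (y : schutz_vertex w) : bool :=
  cayley_edge (val x) a (val y).

Definition schutz_adj w : rel (schutz_vertex w) := ladj (@schutz_edge w).

Lemma scc_init w : cl R (w ++ inv_word w) \in scc cayley_edge (cl R w).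
Proof.
apply/asboolP; split; [exists (inv_word w)|exists w]; apply/cayley_lpath.
  by rewrite cl_cat.
by rewrite -cl_cat -catA; apply/esym/cl_eqP/CongrGen/RelInv.
Qed.

Lemma scc_final w : cl R w \in scc cayley_edge (cl R w).
Proof. by apply/asboolP; split; exists [::]. Qed.

Definition schutz_automaton w : automaton (letter A) :=
  @Automaton _ (schutz_vertex w) (@schutz_edge w)
    (Sub (cl R (w ++ inv_word w)) (scc_init w)) (Sub (cl R w) (scc_final w)).

End Schutzenberger.

Definition connected_graph (V : eqType) (e : rel V) : Prop :=
  forall x y, exists2 p, path e x p & last x p = y.

(* The path metric; the value [0] for unconnected [x], [y] is a dummy, as this
   is only used for connected graphs. *)
Definition dist (V : eqType) (e : rel V) (x y : V) : nat :=
  if pselect (exists n,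
      `[< exists p, [/\ path e x p, last x p = y & size p = n] >]) is left h
  then ex_minn h else 0.

(* The bound 2 allows the closed walks [x, y] going back and forth along an
   edge. *)
Definition is_tree (T : eqType) (e : rel T) : Prop :=
  [/\ inhabited T, symmetric e, irreflexive e, connected_graph e
    & forall c, ucycle e c -> size c <= 2].

Section QuasiIsometry.
Import GRing.Theory Num.Theory.
Local Open Scope ring_scope.

Definition quasi_isometric (X Y : Type) (dX : X -> X -> nat) (dY : Y -> Y -> nat)
    : Prop :=
  exists (f : X -> Y) (k c : Rdefinitions.R), [/\ 1 <= k, 0 <= c,
    forall x x', k^-1 * (dX x x')%:R - c <= (dY (f x) (f x'))%:R
                   <= k * (dX x x')%:R + c
  & forall y, exists x, (dY (f x) y)%:R <= c].

End QuasiIsometry.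

Definition tree_like (V : eqType) (e : rel V) : Prop :=
  exists (T : eqType) (t : rel T),
    is_tree t /\ quasi_isometric (dist e) (dist t).

(* A transition [(q, a, Z, q', g)] reads [a] (or nothing, if [a = None]) in
   state [q] with [Z] on top of the stack, moves to [q'] and replaces [Z] by
   [g]. The head of a stack is its top. *)
Record pda (L : Type) := Pda {
  pda_state : finType;
  pda_stack : finType;
  pda_trans : seq (pda_state * option L * pda_stack * pda_state * seq pda_stack);
  pda_init : pda_state;
  pda_bottom : pda_stack;
  pda_final : {pred pda_state}
}.

Arguments pda_trans {L} p.
Arguments pda_init {L} p.
Arguments pda_bottom {L} p.
Arguments pda_final {L} p.

Definition pda_config (L : Type) (P : pda L) : Type :=
  (pda_state P * seq L * seq (pda_stack P))%type.

Inductive pda_run (L : Type) (P : pda L) :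
    pda_config P -> pda_config P -> Prop :=
| PdaStop c : pda_run c c
| PdaEps q u Z s q' g c :
    List.In (q, None, Z, q', g) (pda_trans P) ->
    pda_run (q', u, g ++ s) c -> pda_run (q, u, Z :: s) c
| PdaRead q a u Z s q' g c :
    List.In (q, Some a, Z, q', g) (pda_trans P) ->
    pda_run (q', u, g ++ s) c -> pda_run (q, a :: u, Z :: s) c.

Definition pda_language (L : Type) (P : pda L) : set (seq L) :=
  [set u | exists2 q, q \in pda_final P &
     exists s, pda_run (pda_init P, u, [:: pda_bottom P]) (q, [::], s)]%classic.

Definition context_free (L : Type) (K : set (seq L)) : Prop :=
  exists P : pda L, K = pda_language P.

Lemma inv_letterK (A : Type) : involutive (@inv_letter A).
Proof. by case=> a b; rewrite /inv_letter /= negbK. Qed.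

Lemma inv_wordK (A : Type) : involutive (@inv_word A).
Proof.
by move=> u; rewrite /inv_word map_rev revK (mapK (@inv_letterK A)).
Qed.

Section Consistency.
Variables (A : finType) (R : seq (word A * word A)).
Implicit Types (s t e : inv_pres R) (u v w : word A).

Lemma cl_inv u : cl R u * cl R (inv_word u) * cl R u = cl R u.
Proof. by rewrite -!cl_cat -catA; apply/cl_eqP/CongrGen/RelInv. Qed.

Lemma cl_comm u v : let e := cl R u * cl R (inv_word u) in
  let f := cl R v * cl R (inv_word v) in e * f = f * e.
Proof. by rewrite /= -!cl_cat -!catA; apply/cl_eqP/CongrGen/RelComm. Qed.

Lemma cl_inv' u :
  cl R (inv_word u) * cl R u * cl R (inv_word u) = cl R (inv_word u).
Proof. by have := cl_inv (inv_word u); rewrite inv_wordK. Qed.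

Lemma idem_cl u : idempotent_elt (cl R u) -> cl R u = cl R u * cl R (inv_word u).
Proof.
have := cl_comm u (inv_word u); have := cl_inv' u; have := cl_inv u.
rewrite inv_wordK /idempotent_elt.
move: (cl R u) (cl R (inv_word u)) => e i eie iei comm ee.
have iE : i = (e * i) * (i * e) by rewrite comm mulgA -(mulgA i e e) ee iei.
have ei : e * i = i by rewrite iE !mulgA ee.
have ie : i * e = i by rewrite iE -!mulgA ee.
by rewrite ei -[LHS]eie ei ie.
Qed.

Lemma idem_comm e f : idempotent_elt e -> idempotent_elt f -> e * f = f * e.
Proof.
rewrite -(inv_pres_repK e) -(inv_pres_repK f) => /idem_cl he /idem_cl hf.
by rewrite he hf; exact: cl_comm.
Qed.

Lemma inv_pres_inverse : inverse_monoid (inv_pres R).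
Proof.
move=> s; rewrite -(inv_pres_repK s); set u := inv_pres_rep s.
exists (cl R (inv_word u)); have := cl_inv' u; have := cl_inv u.
move: (cl R u) (cl R (inv_word u)) => {u}s i sis isi; split=> // t [sts tst].
have is_idem : idempotent_elt (i * s) by rewrite /idempotent_elt mulgA isi.
have si_idem : idempotent_elt (s * i) by rewrite /idempotent_elt mulgA sis.
have ts_idem : idempotent_elt (t * s) by rewrite /idempotent_elt mulgA tst.
have st_idem : idempotent_elt (s * t) by rewrite /idempotent_elt mulgA sts.
have is_ts : i * s = t * s.
  rewrite -[in LHS]sts -(mulgA s) (mulgA i) (idem_comm is_idem ts_idem).
  by rewrite -mulgA (mulgA s) sis.
have si_st : s * i = s * t.
  by rewrite -[in LHS]sts -(mulgA (s * t)) (idem_comm st_idem si_idem) mulgA sis.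
by rewrite -isi is_ts -mulgA si_st mulgA tst.
Qed.

Lemma schutz_edge_inv w (x y : schutz_vertex R w) a :
  schutz_edge x a y = schutz_edge y (inv_letter a) x.
Proof.
suff main (p q : schutz_vertex R w) b :
    schutz_edge p b q -> schutz_edge q (inv_letter b) p.
  by apply/idP/idP => /main //; rewrite inv_letterK.
case: p q {x y} => [s hs] [t ht]; rewrite /schutz_edge /cayley_edge /= => /eqP tE.
move: hs ht => /asboolP[[u1 /cayley_lpath s1] _] /asboolP[_ [u2 /cayley_lpath s2]].
have sE : s = s * cl R ([:: b] ++ u2 ++ u1) by rewrite !cl_cat !mulgA -tE -s2.
set v := [:: b] ++ u2 ++ u1 in sE.
have vE : cl R [:: b] * cl R (inv_word [:: b]) * cl R v = cl R v.
  by rewrite /v cl_cat mulgA cl_inv.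
have vb := cl_comm v [:: b]; have vv := cl_inv v; rewrite /= in vb.
move: (cl R v) (cl R (inv_word v)) sE vE vb vv => x x' sE vE vb vv.
suff sg : s * (x * x') = s.
  have sb : s * (cl R [:: b] * cl R (inv_word [:: b])) = s.
    by rewrite -{1}sg -mulgA vb (mulgA (_ * cl R (inv_word _))) vE sg.
  by apply/eqP; rewrite tE -mulgA sb.
pose r := inv_pres_rep s; have := cl_inv' r; have := cl_inv r.
rewrite inv_pres_repK; move: (cl R (inv_word r)) => i sis isi.
have gi : idempotent_elt (x * x') by rewrite /idempotent_elt mulgA vv.
have ei : idempotent_elt (i * s) by rewrite /idempotent_elt mulgA isi.
have ex : i * s * x = i * s by rewrite -mulgA -sE.
have eg : (i * s) * (x * x') = i * s.
  rewrite (idem_comm ei gi) -[in LHS]ex (mulgA (x * x')) -(idem_comm ei gi).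
  by rewrite -mulgA vv.
by rewrite -{1}sis -(mulgA s) -(mulgA s) eg mulgA sis.
Qed.

Lemma schutz_adj_sym w : symmetric (@schutz_adj A R w).
Proof.
by move=> x y; apply/existsP/existsP => -[a]; rewrite schutz_edge_inv;
  exists (inv_letter a).
Qed.

Lemma schutz_connected w : connected_graph (@schutz_adj A R w).
Proof.
have trans s t e : lconnect (@cayley_edge A R) s t ->
    lconnect (@cayley_edge A R) t e -> lconnect (@cayley_edge A R) s e.
  move=> [u /cayley_lpath ->] [v /cayley_lpath ->].
  by exists (u ++ v); apply/cayley_lpath; rewrite cl_cat mulgA.
move=> x y.
have [u] : lconnect (@cayley_edge A R) (val x) (val y).
  have /asboolP[_ xw] := valP x; have /asboolP[wy _] := valP y.
  exact: trans xw wy.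
elim: u x => [|a u IHu] x /=; first by move/val_inj->; exists [::].
case=> z xz zy.
have zP : z \in scc (@cayley_edge A R) (cl R w).
  have /asboolP[wx _] := valP x; have /asboolP[_ yw] := valP y.
  apply/asboolP; split; last by apply: trans yw; exists u.
  by apply: trans wx _; exists [:: a], z.
have [p zp yp] := IHu (Sub z zP) zy.
exists (Sub z zP :: p) => //=; rewrite zp andbT.
by apply/existsP; exists a.
Qed.

End Consistency.

(* Main.v *)
Require Import Defs.
From mathcomp Require Import all_boot all_order all_algebra.
From mathcomp Require Import boolp classical_sets reals Rstruct.
From mathcomp Require Import lra zify.

Set Implicit Arguments.
Unset Strict Implicit.
Unset Printing Implicit Defensive.

(* Let [o] be the initial vertex of the Schützenberger graph, and call a
   connected component of the set of vertices at distance at least [k] from [o]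
   a cone. In a quasi-tree the boundary of a cone has bounded diameter, so the
   collar of vertices within a fixed distance [N] of the boundary takes only
   finitely many isomorphism types. If [N] bounds the lengths of the relators
   and the cone lies beyond the path of [w], then the type of the collar
   determines the whole cone: replacing a cone by another one with the same
   collar yields an inverse graph which is still closed under the relators and
   still reads [w], so the Schützenberger graph maps to it, and likewise with
   the two cones exchanged. Hence the languages of labels of paths between two
   collar vertices inside cone and collar form a finite family. A path between
   two collar vertices meets the collar in between or dives into a cone [N + 1]
   levels deeper whose collar contains its ends and its second vertex, so
   these languages satisfy a finite context-free grammar. *)

(** * Paths in labelled graphs *)

Section Paths.
Variables (L V : Type) (E : V -> L -> V -> Prop).
Implicit Types (x y z : V) (u v : seq L) (Q : V -> Prop).

Fixpoint path_in Q x u y : Prop :=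
  Q x /\ if u is a :: u' then exists2 z, E x a z & path_in Q z u' y else x = y.

Definition reads := path_in (fun=> True).

Definition deterministic : Prop :=
  forall x a y z, E x a y -> E x a z -> y = z.

Lemma path_in_ends Q x u y : path_in Q x u y -> Q x /\ Q y.
Proof.
elim: u x => [|a u IHu] x /= [Qx]; first by move=> <-.
by case=> z _ /IHu[].
Qed.

Lemma path_in_cat Q x u v y :
  path_in Q x (u ++ v) y <-> exists2 z, path_in Q x u z & path_in Q z v y.
Proof.
elim: u x => [|a u IHu] x /=; split.
- by move=> xy; exists x => //; split=> //; have [] := path_in_ends xy.
- by case=> z [_ ->].
- by case=> Qx [z xz /IHu[t zt ty]]; exists t => //; split=> //; exists z.
by case=> t [Qx [z xz zt]] ty; split=> //; exists z => //; apply/IHu; exists t.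
Qed.

Lemma path_in_rcons Q x u a y z :
  path_in Q x u y -> E y a z -> Q z -> path_in Q x (rcons u a) z.
Proof.
move=> xy yz Qz; rewrite -cats1; apply/path_in_cat; exists y => //=.
by split; [have [] := path_in_ends xy | exists z].
Qed.

Lemma path_in_sub Q Q' x u y :
  (forall z, Q z -> Q' z) -> path_in Q x u y -> path_in Q' x u y.
Proof.
move=> QQ'; elim: u x => [|a u IHu] x /= [/QQ' Qx]; first by move=> <-.
by case=> z xz /IHu zy; split=> //; exists z.
Qed.

Lemma path_in_reads Q x u y : path_in Q x u y -> reads x u y.
Proof. exact: path_in_sub. Qed.

Lemma path_in_invariant Q x u y :
  (forall z a t, Q z -> E z a t -> Q t) -> Q x -> reads x u y -> path_in Q x u y.
Proof.
move=> Qstep; elim: u x => [|a u IHu] x Qx [_] /=; first by move=> <-.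
by case=> z xz /IHu zy; split=> //; exists z => //; apply/zy/Qstep/xz.
Qed.

Lemma path_in_det Q Q' x u y z : deterministic ->
  path_in Q x u y -> path_in Q' x u z -> y = z.
Proof.
move=> detE; elim: u x => [|a u IHu] x /= [_ xy] [_ xz]; first by rewrite -xy.
case: xy xz => [y' xy' /IHu yy] [z' xz' zz].
by apply: yy; rewrite (detE _ _ _ _ xy' xz').
Qed.

Lemma path_inI Q Q' x u y : deterministic ->
  path_in Q x u y -> path_in Q' x u y -> path_in (fun z => Q z /\ Q' z) x u y.
Proof.
move=> detE; elim: u x => [|a u IHu] x /= [Qx xy] [Q'x xz]; first by [].
case: xy xz => [y' xy' /IHu yy] [z' xz' zz].
split=> //; exists y' => //; apply: yy.
by rewrite (detE _ _ _ _ xy' xz').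
Qed.

Section Region.
Variable C : V -> Prop.

(** The boundary is two-sided: it contains the ends of crossing edges outside [C] as well as those
    inside, so collars extend to both sides. *)
Definition crossing x : Prop := exists a y, E x a y /\ ~ (C x <-> C y).

Definition near j x : Prop :=
  exists b u, [/\ size u <= j, crossing b & reads b u x].

Lemma crossing_near j x : crossing x -> near j x.
Proof. by move=> cx; exists x, [::]. Qed.

Lemma near_leq i j x : i <= j -> near i x -> near j x.
Proof. by move=> ij [b [u [ui cb bx]]]; exists b, u; split=> //; exact: leq_trans ij. Qed.

Lemma near_edge j x a y : near j x -> E x a y -> near j.+1 y.
Proof.
case=> b [u [uj cb bx]] xy; exists b, (rcons u a); split=> //.
  by rewrite size_rcons.
exact: path_in_rcons xy _.
Qed.

Lemma near_path j x u y : near j x -> reads x u y ->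
  path_in (near (j + size u)) x u y.
Proof.
elim: u x j => [|a u IHu] x j nx /= [_]; first by rewrite addn0.
case=> z xz zy; split; first exact: near_leq (leq_addr _ _) nx.
by exists z => //; rewrite addnS -addSn; exact: IHu (near_edge nx xz) zy.
Qed.

End Region.
End Paths.

Section InvolutivePaths.
Variables (A V : Type) (E : V -> letter A -> V -> Prop).
Implicit Types (x y z : V) (u v : word A) (Q : V -> Prop).

Definition involutive_graph : Prop :=
  forall x a y, E x a y -> E y (inv_letter a) x.

Hypothesis symE : involutive_graph.

Lemma path_in_inv Q x u y : path_in E Q x u y -> path_in E Q y (inv_word u) x.
Proof.
elim: u x => [|a u IHu] x /= [Qx]; first by move=> <-.
case=> z xz /IHu zy; rewrite /inv_word /= rev_cons.
exact: path_in_rcons zy (symE xz) Qx.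
Qed.

Lemma crossing_sym C x a y : E x a y -> ~ (C x <-> C y) ->
  crossing E C x /\ crossing E C y.
Proof.
move=> xy nC; split; first by exists a, y.
exists (inv_letter a), x; split; first exact: symE.
by move=> CC; apply: nC; split=> /CC.
Qed.

(** Once an edge of the path crosses the boundary, every vertex of the path is within [size u] steps
    of that edge. A path of length at most [N] that changes sides is thus confined to the collar. *)
Lemma side_or_near C x u y : reads E x u y ->
  path_in E (fun z => C z <-> C x) x u y \/ path_in E (near E C (size u)) x u y.
Proof.
elim: u x => [|a u IHu] x /= [_]; first by left.
case=> z xz zy; have [zx|nzx] := pselect (C z <-> C x); last first.
  have /(crossing_sym xz)[cx cz] : ~ (C x <-> C z) by move=> h; apply: nzx; split=> /h.
  right; split; first exact: crossing_near.
  exists z => //; apply: path_in_sub _ (near_path (crossing_near 0 cz) zy) => t.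
  exact: near_leq.
have [zs|zn] := IHu _ zy.
  left; split=> //; exists z => //; apply: path_in_sub _ zs => t h.
  by split=> [/h/zx|/zx/h].
have [nz _] := path_in_ends zn.
right; split; first exact: near_edge nz (symE xz).
exists z => //; apply: path_in_sub _ zn => t; exact: near_leq.
Qed.

End InvolutivePaths.

(** * Congruent words label the same paths *)

Section RelatorClosed.
Variables (A : finType) (R : seq (word A * word A)).
Variables (V : Type) (E : V -> letter A -> V -> Prop).
Hypotheses (detE : deterministic E) (symE : involutive_graph E).
Variable D : V -> Prop.
Hypothesis DE : forall x a y, D x -> E x a y -> D y.
Hypothesis relE : forall u v, (u, v) \in R ->
  forall x y, D x -> (reads E x u y <-> reads E x v y).

Lemma reads_cat x u v y :
  reads E x (u ++ v) y <-> exists2 z, reads E x u z & reads E z v y.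
Proof. exact: path_in_cat. Qed.

Lemma reads_inv x u y : reads E x u y -> reads E y (inv_word u) x.
Proof. exact: path_in_inv. Qed.

Lemma reads_det x u y z : reads E x u y -> reads E x u z -> y = z.
Proof. exact: path_in_det. Qed.

Lemma reads_dom x u y : D x -> reads E x u y -> D y.
Proof. by move=> Dx xy; have [] := path_in_ends (path_in_invariant DE Dx xy). Qed.

Lemma reads_idem x u y :
  reads E x (u ++ inv_word u) y <-> x = y /\ exists z, reads E x u z.
Proof.
rewrite reads_cat; split=> [[z xz zy]|[<- [z xz]]].
  by split; [exact: reads_det (reads_inv xz) zy | exists z].
by exists z => //; exact: reads_inv.
Qed.

(** In a deterministic involutive graph a word followed by its inverse can only label a closed path,
    so it merely tests whether the word is readable; such tests commute. Hence the relations of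
    inverse monoids hold by themselves, and [relE] supplies those of [R]. *)
Lemma reads_congr u v : congr_closure (relator R) u v ->
  forall x y, D x -> (reads E x u y <-> reads E x v y).
Proof.
elim=> {u v}.
- move=> _ _ [u v uv|u|u v] x y Dx; first exact: relE.
    rewrite reads_cat; split.
      case=> z xz /reads_cat[t zt ty].
      by rewrite -(reads_det (reads_inv xz) zt) in ty.
    move=> xy; exists y => //; apply/reads_cat; exists x => //; exact: reads_inv.
  rewrite !catA -![(_ ++ u) ++ _]catA -![(_ ++ v) ++ _]catA !(reads_cat _ (_ ++ _)).
  by split=> -[z /reads_idem[<- [s xs]] /reads_idem[<- [t xt]]];
    exists x; apply/reads_idem; split=> //; [exists t|exists s|exists t|exists s].
- by [].
- by move=> u v _ IH x y Dx; split=> /(IH _ _ Dx).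
- by move=> u v t _ IH1 _ IH2 x y Dx; split=> [/IH1/IH2|/IH2/IH1]; exact.
- move=> u u' v v' _ IHu _ IHv x y Dx; rewrite !reads_cat; split=> -[z xz zy];
  exists z.
  + exact/IHu.
  + by apply/IHv => //; exact: reads_dom xz.
  + exact/IHu.
  + by apply/IHv => //; apply: reads_dom xz.
Qed.

End RelatorClosed.

(** * Gluing the outside of one region to another region *)

Section Matching.
Variables (A V : Type) (E : V -> letter A -> V -> Prop) (N : nat).

(* [rho] is an isomorphism between the collars of width [N] around the
   boundaries of [C] and [C']. *)
Definition matching (C C' : V -> Prop) (rho : V -> V -> Prop) : Prop :=
  [/\ forall x x', rho x x' -> [/\ near E C N x, near E C' N x' & C x <-> C' x'],
      forall x, near E C N x -> exists x', rho x x',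
      forall x', near E C' N x' -> exists x, rho x x',
      forall x x' y y', rho x x' -> rho y y' -> (x = y <-> x' = y')
    & forall x x' y y' a, rho x x' -> rho y y' -> (E x a y <-> E x' a y')].

Lemma matching_sym C C' rho :
  matching C C' rho -> matching C' C (fun x' x => rho x x').
Proof.
move=> [rn rdom rcod rinj rE]; split=> //.
- by move=> x x' /rn[nx nx' CC]; split=> //; split=> /CC.
- by move=> x x' y y' rx ry; split=> /(rinj _ _ _ _ rx ry).
by move=> x x' y y' a rx ry; split=> /(rE _ _ _ _ _ rx ry).
Qed.

End Matching.

Section Glue.
Variables (A : finType) (V : Type) (E : V -> letter A -> V -> Prop) (N : nat).
Hypotheses (detE : deterministic E) (symE : involutive_graph E).
Variables (C C' : V -> Prop) (rho : V -> V -> Prop).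
Hypothesis rhoP : matching E N C C' rho.
Implicit Types (x y z : V) (p q : V + V) (u v : word A).

Definition glue_dom p : Prop :=
  match p with inl x => ~ C x | inr x' => C' x' end.

(** The left copy contributes the outside of [C], the right copy the inside of [C']. At the seam,
    the end in [C] of a crossing edge is replaced by its [rho]-partner. Elements of [V + V] outside
    [glue_dom] are isolated. *)
Definition glue_edge p a q : Prop :=
  match p, q with
  | inl x, inl y => [/\ E x a y, ~ C x & ~ C y]
  | inr x', inr y' => [/\ E x' a y', C' x' & C' y']
  | inl x, inr y' => exists y, [/\ E x a y, ~ C x, C y & rho y y']
  | inr x', inl y => exists x, [/\ E x a y, C x, ~ C y & rho x x']
  end.

Definition emb x p : Prop :=
  match p with inl y => x = y /\ ~ C x | inr x' => C x /\ rho x x' end.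

Lemma rho_near x x' : rho x x' -> [/\ near E C N x, near E C' N x' & C x <-> C' x'].
Proof. by case: rhoP => + _ _ _ _; apply. Qed.

Lemma rho_dom x : near E C N x -> exists x', rho x x'.
Proof. by case: rhoP => _ + _ _ _; apply. Qed.

Lemma rho_cod x' : near E C' N x' -> exists x, rho x x'.
Proof. by case: rhoP => _ _ + _ _; apply. Qed.

Lemma rho_inj x x' y y' : rho x x' -> rho y y' -> (x = y <-> x' = y').
Proof. by case: rhoP => _ _ _ + _; apply. Qed.

Lemma rho_edge x x' y y' a : rho x x' -> rho y y' -> (E x a y <-> E x' a y').
Proof. by case: rhoP => _ _ _ _; apply. Qed.

Lemma rho_crossing x x' y y' a : rho x x' -> rho y y' -> E x a y ->
  ~ (C x <-> C y) -> crossing E C' x' /\ crossing E C' y'.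
Proof.
move=> rx ry xy nC; apply: (@crossing_sym _ _ E symE C' x' a y').
  exact/(rho_edge _ rx ry).
have [_ _ CC] := rho_near rx; have [_ _ CC2] := rho_near ry.
by move=> [h1 h2]; apply: nC; split=> [/CC/h1/CC2|/CC2/h2/CC].
Qed.

Lemma crossing_rho x a y : E x a y -> ~ (C x <-> C y) ->
  (exists x', rho x x') /\ (exists y', rho y y').
Proof.
by move=> xy /(crossing_sym symE xy)[cx cy];
  split; apply/rho_dom/crossing_near.
Qed.

Lemma glue_edge_dom p a q : glue_edge p a q -> glue_dom p /\ glue_dom q.
Proof.
case: p q => [x|x'] [y|y'] /=; first by case.
- by case=> z [_ nx Cz rz]; split=> //; have [_ _ h] := rho_near rz; exact/h.
- by case=> z [_ Cz nx rz]; split=> //; have [_ _ h] := rho_near rz; exact/h.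
by case.
Qed.

Lemma glue_edge_sym : involutive_graph glue_edge.
Proof.
case=> [x|x'] a [y|y'] /=.
- by case=> /symE.
- by case=> z [xz nx Cz rz]; exists z; split=> //; exact: symE.
- by case=> z [xz nx Cz rz]; exists z; split=> //; exact: symE.
by case=> /symE.
Qed.

(** The delicate case is a vertex of the right copy with an inner edge and a seam edge of the same
    label. Carried through [rho], the seam edge becomes an edge of [E] ending outside [C'], while
    the inner one ends in [C']. *)
Lemma glue_edge_det : deterministic glue_edge.
Proof.
have aux x a y y' : [/\ E x a y, C' x & C' y] ->
    ~ exists z, [/\ E z a y', C z, ~ C y' & rho z x].
  move=> [xy _ Cy] [z [zy' Cz nCy' rz]].
  have [_ [y'' ry]] : (exists x', rho z x') /\ exists y'', rho y' y''.
    by apply: crossing_rho zy' _; case=> + _ => /(_ Cz).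
  have := (rho_edge a rz ry).1 zy' => xy''.
  have yy := detE xy xy''.
  by have [_ _ [_ h]] := rho_near ry; apply/nCy'/h; rewrite -yy.
case=> [x|x'] a [y|y'] [z|z'] //=.
- by move=> [xy _ _] [/(detE xy)->].
- by move=> [xy _ nCy] [t [/(detE xy)<-]].
- by move=> [t [xt _ Ct _]] [/(detE xt)<-].
- move=> [t [xt _ _ rt]] [s [/(detE xt)<- _ _ rs]].
  by have := (rho_inj rt rs).1 erefl => ->.
- move=> [t [ty _ _ rt]] [s [sz _ _ rs]].
  by have := (rho_inj rt rs).2 erefl => st; rewrite -st in sz; rewrite (detE ty sz).
- by move=> h1 /aux/(_ h1).
- by move=> /aux h /h.
- by move=> [xy _ _] [/(detE xy)->].
Qed.

Lemma emb_inj x p q : emb x p -> emb x q -> p = q.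
Proof.
case: p q => [y|y] [z|z] /= [] => [<- _ [<-]|-> nC []|Cx _ [_ /(_ Cx)]|] //.
by move=> Cx rx [_ rz]; have := (rho_inj rx rz).1 erefl => ->.
Qed.

Lemma near_emb x : near E C N x -> exists p, emb x p.
Proof.
move=> /rho_dom[x' rx].
have [Cx|nCx] := pselect (C x); first by exists (inr x').
by exists (inl x).
Qed.

Lemma emb_edge x y p q a : emb x p -> emb y q -> (E x a y <-> glue_edge p a q).
Proof.
case: p q => [x'|x'] [y'|y'] /=.
- by move=> [<- nx] [<- ny]; split=> [|[]].
- move=> [<- nx] [Cy ry]; split=> [xy|[z [xz _ _ rz]]]; first by exists y.
  by have -> := (rho_inj ry rz).2 erefl.
- move=> [Cx rx] [<- ny]; split=> [xy|[z [zy _ _ rz]]]; first by exists x.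
  by have -> := (rho_inj rx rz).2 erefl.
move=> [Cx rx] [Cy ry]; rewrite (rho_edge a rx ry); split=> [xy|[]//].
have [_ _ h] := rho_near rx; have [_ _ k] := rho_near ry.
by split=> //; [exact/h|exact/k].
Qed.

Lemma emb_path x u y p : path_in E (fun z => exists q, emb z q) x u y ->
  emb x p -> exists2 q, emb y q & reads glue_edge p u q.
Proof.
elim: u x p => [|a u IHu] x p /= [[_ _]]; first by move=> -> yp; exists p.
case=> z xz zy xp; have [[q zq] _] := path_in_ends zy.
have [r yr qr] := IHu _ _ zy zq; exists r => //; split=> //.
by exists q => //; exact/(emb_edge a xp zq).
Qed.

Lemma path_unemb p u q x : path_in glue_edge (fun r => exists z, emb z r) p u q ->
  emb x p -> exists2 y, emb y q & reads E x u y.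
Proof.
elim: u x p => [|a u IHu] x p /= [[_ _]]; first by move=> -> xq; exists x.
case=> r pr rq xp; have [[z zr] _] := path_in_ends rq.
have [y yq zy] := IHu _ _ rq zr; exists y => //; split=> //.
by exists z => //; exact/(emb_edge a xp zr).
Qed.

Definition glue_side p : Prop := if p is inr _ then True else False.

Definition glue_near j p : Prop :=
  match p with inl x => near E C j x | inr x' => near E C' j x' end.

Lemma glue_edge_crossing p a q : glue_edge p a q ->
  ~ (glue_side p <-> glue_side q) -> glue_near 0 p /\ glue_near 0 q.
Proof.
have main x y y' b : [/\ E x b y, ~ C x, C y & rho y y'] ->
    near E C 0 x /\ near E C' 0 y'.
  move=> [xy nx Cy ry]; have nC : ~ (C x <-> C y) by case=> _ /(_ Cy).
  have [[x' rx] _] := crossing_rho xy nC.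
  have [cx' cy'] := rho_crossing rx ry xy nC.
  have [cx cy] := crossing_sym symE xy nC.
  by split; exact: crossing_near.
case: p q => [x|x'] [y|y'] /=.
- by move=> _ [].
- by case=> z /main.
- by case=> z [zy Cz ny rz]; have [] := main y z x' (inv_letter a);
    split=> //; exact: symE.
by move=> _ [].
Qed.

(** Edges within a copy are edges of [E], and both ends of a seam edge are boundary vertices of
    their own copies, where the count of steps restarts at 0. *)
Lemma glue_near_side j p : near glue_edge glue_side j p -> glue_near j p.
Proof.
have step i q a r : glue_near i q -> glue_edge q a r -> glue_near i.+1 r.
  move=> nq qr; have [|/(glue_edge_crossing qr)[_]] :=
    pselect (glue_side q <-> glue_side r); last first.
    by case: r qr => [y|y'] _ /=; exact: near_leq.
  case: q r nq qr => [x|x'] [y|y'] //= nx; last 1 first.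
  - by case=> xy _ _ _; exact: near_edge xy.
  - by case=> xy _ _ _; exact: near_edge xy.
  - by move=> _ [_ []].
  - by move=> _ [[]].
case=> b [u [uj [a [c [bc nbc]]] bp]].
have [b0 _] := glue_edge_crossing bc nbc.
suff main i : glue_near i b -> glue_near (i + size u) p.
  by case: p {bp main} (main _ b0) => [x|x'] /=; exact: near_leq.
elim: u b i bp {uj bc nbc b0} => [|d u IHu] b i /= [_].
  by move=> <-; rewrite addn0.
by case=> r br rp bi; rewrite addnS -addSn; apply: IHu rp _; exact: step br.
Qed.

Lemma glue_near_emb p : glue_dom p -> glue_near N p -> exists x, emb x p.
Proof.
case: p => [x nCx _|x' Cx' /rho_cod[x rx]] /=; first by exists x.
by exists x; split=> //; have [_ _ h] := rho_near rx; exact/h.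
Qed.

End Glue.

(** * The gluing respects the relators *)

Section GlueClosed.
Variables (A : finType) (V : Type) (E : V -> letter A -> V -> Prop) (N : nat).
Hypotheses (detE : deterministic E) (symE : involutive_graph E).
Variables (C C' : V -> Prop) (rho : V -> V -> Prop).
Hypothesis rhoP : matching E N C C' rho.
Implicit Types (x y z : V) (p q : V + V) (u v : word A).

Let G := glue_edge E C C' rho.
Let dom := glue_dom C C'.
Let em := emb C rho.

(** A path of length at most [N] from the seam lifts through [emb] edge by edge, and its start lifts
    to a boundary vertex of [C] because both ends of the seam edge lift. *)
Lemma near_unemb j p : j <= N -> dom p -> near G (@glue_side V) j p ->
  exists2 x, em x p & near E C j x.
Proof.
move=> jN _ [b [u [uj [a [c [bc nbc]]] bp]]].
have [db dc] := glue_edge_dom rhoP bc.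
have [b0 c0] := glue_edge_crossing symE rhoP bc nbc.
have nearN r : glue_near E C C' 0 r -> glue_near E C C' N r.
  by case: r => [x|x'] /=; exact: near_leq.
have [z zb] := glue_near_emb rhoP db (nearN _ b0).
have [t tc] := glue_near_emb rhoP dc (nearN _ c0).
have cz : crossing E C z.
  exists a, t; split; first exact/(emb_edge rhoP a zb tc).
  move=> zt; apply: nbc.
  by case: (b) zb => [?|?]; case: (c) tc => [?|?] /= -[h1 h2] [h3 h4];
    rewrite /= in h1 h2 h3 h4 zt *; tauto.
have nb : near G (@glue_side V) 0 b by apply: crossing_near; exists a, c.
have np := near_path nb bp.
have dp := path_in_invariant (fun r d s _ rs => (glue_edge_dom rhoP rs).2) db bp.
have npd := path_inI (glue_edge_det detE symE rhoP) np dp.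
have [|y yp zy] := path_unemb rhoP (path_in_sub _ npd) zb.
  move=> r [nr dr]; apply: (glue_near_emb rhoP dr).
  apply: (glue_near_side symE rhoP); apply: near_leq nr.
  exact: leq_trans uj jN.
by exists y => //; exists z, u.
Qed.

Lemma rho_path x x' v y' : path_in E (near E C' N) x' v y' -> rho x x' ->
  exists2 y, rho y y' & path_in E (near E C N) x v y.
Proof.
elim: v x x' => [|a v IHv] x x' /= [nx'].
  by move=> <- rx; exists x => //; split=> //; have [] := rho_near rhoP rx.
case=> z' xz' zy' rx; have [nz' _] := path_in_ends zy'.
have [z rz] := rho_cod rhoP nz'.
have [y ry zy] := IHv _ _ zy' rz; exists y => //; split.
  by have [] := rho_near rhoP rx.
by exists z => //; exact/(rho_edge rhoP a rx rz).
Qed.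

Lemma glue_inl_path x u y :
  path_in E (fun z => ~ C z) x u y -> reads G (inl x) u (inl y).
Proof.
elim: u x => [|a u IHu] x /= [nx]; first by move=> ->.
case=> z xz zy; split=> //; exists (inl z); last exact: IHu.
by have [nz _] := path_in_ends zy.
Qed.

Lemma glue_inr_path x u y :
  path_in E C' x u y -> reads G (inr x) u (inr y).
Proof.
elim: u x => [|a u IHu] x /= [nx]; first by move=> ->.
case=> z xz zy; split=> //; exists (inr z); last exact: IHu.
by have [nz _] := path_in_ends zy.
Qed.

Lemma glue_side_inl x u q : ~ C x ->
  path_in G (fun r => glue_side r <-> False) (inl x) u q ->
  exists2 y, q = inl y & path_in E (fun z => ~ C z) x u y.
Proof.
elim: u x => [|a u IHu] x nx /= [_]; first by move=> <-; exists x.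
case=> -[z|z] xz zq; last by have [/= [/(_ I)]] := path_in_ends zq.
have [y -> zy] := IHu z (and3_rec (fun _ _ h => h) xz) zq.
by exists y => //; split=> //; exists z => //; case: xz.
Qed.

Lemma glue_side_inr x u q : C' x ->
  path_in G (fun r => glue_side r <-> True) (inr x) u q ->
  exists2 y, q = inr y & path_in E C' x u y.
Proof.
elim: u x => [|a u IHu] x nx /= [_]; first by move=> <-; exists x.
case=> -[z|z] xz zq; first by have [/= [_ /(_ I)]] := path_in_ends zq.
have [y -> zy] := IHu z (and3_rec (fun _ _ h => h) xz) zq.
by exists y => //; split=> //; exists z => //; case: xz.
Qed.

Lemma near_emb_path x v y p : path_in E (near E C N) x v y -> em x p ->
  exists2 q, em y q & reads G p v q.
Proof.
move=> xy; apply: (emb_path rhoP); apply: path_in_sub xy => z.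
exact: (near_emb rhoP).
Qed.

(* A relator read across the seam stays in the collar, where both sides agree. *)
Lemma glue_relator u v p q : size u + size v <= N ->
  (forall x y, reads E x u y -> reads E x v y) ->
  dom p -> reads G p u q -> reads G p v q.
Proof.
move=> uvN uv dp pq.
have uN : size u <= N := leq_trans (leq_addr _ _) uvN.
have vN : size v <= N := leq_trans (leq_addl _ _) uvN.
have Gsym : involutive_graph G by exact: glue_edge_sym.
have [side|npq] := side_or_near Gsym (@glue_side V) pq; last first.
  have dq := path_in_invariant (fun r d s _ rs => (glue_edge_dom rhoP rs).2) dp pq.
  have [np nq] := path_in_ends npq.
  have [x xp nx] := near_unemb uN dp np.
  have npqd := path_inI (glue_edge_det detE symE rhoP) npq dq.
  have [|y yq xy] := path_unemb rhoP (path_in_sub _ npqd) xp.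
    by move=> r [nr dr]; have [z zr _] := near_unemb uN dr nr; exists z.
  (* The start is within [size u] of the boundary and [v] makes [size v] further steps: this is why
     [N] bounds the sum of the two lengths. *)
  have xvy := path_in_sub (fun z => near_leq uvN) (near_path nx (uv _ _ xy)).
  have [q' yq' pq'] := near_emb_path xvy xp.
  by rewrite (emb_inj rhoP yq yq').
case: p dp side {pq} => [x|x'] /= dp side.
  have [y -> xy] := glue_side_inl dp side.
  have [_ nCy] := path_in_ends xy.
  (* The path of [u] avoids [C], but that of [v] may enter it; it then lies in the collar and is
     copied by [emb]. *)
  have [xs|xn] := side_or_near symE C (uv _ _ (path_in_reads xy)).
    by apply/glue_inl_path/(path_in_sub _ xs) => z h /h.
  have {}xn := path_in_sub (fun z => near_leq vN) xn.
  have [q' yq' ?] := near_emb_path xn (conj erefl dp : em x (inl x)).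
  by rewrite (emb_inj rhoP (conj erefl nCy : em y (inl y)) yq').
have [y' -> xy'] := glue_side_inr dp side.
have [_ C'y'] := path_in_ends xy'.
have [xs|xn] := side_or_near symE C' (uv _ _ (path_in_reads xy')).
  by apply/glue_inr_path/(path_in_sub _ xs) => z h; exact/h.
have {}xn := path_in_sub (fun z => near_leq vN) xn.
have [nx' _] := path_in_ends xn.
have [x rx] := rho_cod rhoP nx'.
have Cx : C x by have [_ _ h] := rho_near rhoP rx; exact/h.
have [y ry xy] := rho_path xn rx.
have Cy : C y by have [_ _ h] := rho_near rhoP ry; exact/h.
have [q' yq' ?] := near_emb_path xy (conj Cx rx : em x (inr x')).
by rewrite (emb_inj rhoP (conj Cy ry : em y (inr y')) yq').
Qed.

End GlueClosed.

(** * Regions with the same collar have the same languages *)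

Section Transfer.
Variables (A : finType) (R : seq (word A * word A)).
Variables (V : Type) (E : V -> letter A -> V -> Prop) (N : nat).
Hypotheses (detE : deterministic E) (symE : involutive_graph E).
Hypothesis relE : forall u v, (u, v) \in R ->
  forall x y, reads E x u y <-> reads E x v y.
Hypothesis relN : forall u v, (u, v) \in R -> size u + size v <= N.
Variables (o : V) (w : word A).
(** This is how the Schützenberger graph of [w] is the universal one: its vertices are words from
    [o] up to the congruence. *)
Hypothesis initE : forall u v x, reads E o u x -> reads E o v x ->
  congr_closure (relator R) (w ++ inv_word w ++ u) (w ++ inv_word w ++ v).
Implicit Types (x y z : V) (p q : V + V) (u v : word A) (C : V -> Prop).

(** Guarantees that the path of [w], and some path to each outer vertex, survive when [C] is
    replaced in a gluing. *)
Definition rooted C : Prop :=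
  (exists f, path_in E (fun z => ~ C z) o w f) /\
  forall x, ~ C x -> exists u, path_in E (fun z => ~ C z) o u x.

Section Folding.
Variables (C C' : V -> Prop) (rho : V -> V -> Prop).
Hypotheses (rhoP : matching E N C C' rho) (rootC : rooted C).

Let G := glue_edge E C C' rho.

(** The graph of the morphism to the gluing: follow the same word from both base vertices. It is
    single-valued because words leading to the same vertex are congruent after the prefix
    [w ++ inv_word w], which labels a loop at the base of the gluing. *)
Definition fold x p : Prop := exists2 u, reads E o u x & reads G (inl o) u p.

Let detG : deterministic G. Proof. exact (glue_edge_det detE symE rhoP). Qed.
Let symG : involutive_graph G. Proof. exact: glue_edge_sym. Qed.

Lemma notin_origin : ~ C o.
Proof. by have [[f of_] _] := rootC; have [] := path_in_ends of_. Qed.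

Lemma glue_congr u v : congr_closure (relator R) u v ->
  forall q, reads G (inl o) u q <-> reads G (inl o) v q.
Proof.
move=> uv q; apply: (reads_congr detG symG (D := glue_dom C C') _ _ uv) => //.
- by move=> p a r _ pr; have [] := glue_edge_dom rhoP pr.
- move=> {u v uv q} u v uv p r dp.
  have uvN := relN uv.
  have vuN : size v + size u <= N by rewrite addnC.
  by split; apply: (glue_relator detE symE rhoP _ _ dp) => // x y /(relE uv).
exact: notin_origin.
Qed.

Lemma glue_base u q :
  reads G (inl o) (w ++ inv_word w ++ u) q <-> reads G (inl o) u q.
Proof.
have [[f of_] _] := rootC; have Gof := glue_inl_path C' rho of_.
rewrite catA reads_cat; split=> [[p /(reads_idem detG symG)[<- _]]//|oq].
by exists (inl o) => //; apply/(reads_idem detG symG); split=> //; exists (inl f).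
Qed.

Lemma glue_same u v x q : reads E o u x -> reads E o v x ->
  reads G (inl o) u q -> reads G (inl o) v q.
Proof.
by move=> ox ox' oq; apply/glue_base/(glue_congr (initE ox' ox))/glue_base.
Qed.

Lemma fold_total u x : reads E o u x -> exists2 p, fold x p & reads G (inl o) u p.
Proof.
(* This loop and the empty word both lead from [o] to [o], so the gluing reads the loop as well, and
   in particular its prefix [u]. *)
move=> ox; have oo : reads E o (u ++ inv_word u) o.
  by apply/reads_cat; exists x => //; exact: reads_inv.
have /(glue_same (_ : reads E o [::] o) oo) : reads G (inl o) [::] (inl o) by [].
move=> /(_ (conj I erefl))/reads_cat[p op _].
by exists p => //; exists u.
Qed.

Lemma fold_det x p q : fold x p -> fold x q -> p = q.
Proof.
move=> [u ox op] [v ox' /(glue_same ox' ox) oq].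
exact: reads_det detG _ _ _ _ op oq.
Qed.

Lemma fold_edge x p a y : fold x p -> E x a y -> exists2 q, fold y q & G p a q.
Proof.
move=> [u ox op] xy; have oy : reads E o (rcons u a) y by exact: path_in_rcons xy _.
have [q yq] := fold_total oy; rewrite -cats1 => /reads_cat[p' op' [_ [q' pq' [_ qq']]]].
by exists q; rewrite // -qq' (reads_det detG op op').
Qed.

Lemma fold_out x : ~ C x -> fold x (inl x).
Proof.
move=> nCx; have [_ /(_ _ nCx)[u ox]] := rootC; exists u; first exact: path_in_reads ox.
exact: glue_inl_path.
Qed.

Lemma fold_rho x x' : C x -> rho x x' -> fold x (inr x').
Proof.
move=> Cx rx; have [nx _ _] := rho_near rhoP rx.
have [b [u [nCb nu]]] : exists b u, ~ C b /\ path_in E (near E C N) b u x.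
  have [b [u [uN [a [c [bc nbc]]] bx]]] := nx.
  have [cb cc] := crossing_sym symE bc nbc.
  have nbx : path_in E (near E C N) b u x.
    apply: path_in_sub (near_path (crossing_near 0 cb) bx) => z.
    exact: near_leq.
  (* A start inside [C] is exchanged for the other end of its crossing edge. The path gets one
     letter longer, but only its staying in the collar matters. *)
  have [Cb|nCb] := pselect (C b); last by exists b, u.
  have nCc : ~ C c by move=> Cc; apply: nbc.
  exists c, (inv_letter a :: u); split=> //; split; first exact: crossing_near.
  by exists b => //; exact: symE.
have [q xq bq] := near_emb_path rhoP nu (conj erefl nCb : emb C rho b (inl b)).
rewrite (emb_inj rhoP (conj Cx rx : emb C rho x (inr x')) xq).
have [v ob obG] := fold_out nCb.
exists (v ++ u); apply/reads_cat; first by exists b => //; exact: path_in_reads nu.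
by exists (inl b).
Qed.

End Folding.

Section Lockstep.
Variables (C C' : V -> Prop) (rho : V -> V -> Prop).
Hypotheses (rhoP : matching E N C C' rho) (rootC : rooted C) (rootC' : rooted C').

Let rhoP' := matching_sym rhoP.

(* On the collar, folding the graph into a gluing and into the swapped gluing
   are mutually inverse; this propagates along paths inside the cones. *)
Let twin x x' : Prop := [/\ C x, C' x', fold C C' rho x (inr x')
  & fold C' C (fun x' x => rho x x') x' (inr x)].

Lemma rho_twin x x' : C x -> rho x x' -> twin x x'.
Proof.
move=> Cx rx; have [_ _ CC] := rho_near rhoP rx; have Cx' := CC.1 Cx.
by split=> //; [exact: fold_rho | exact: (fold_rho rhoP' rootC' Cx' rx)].
Qed.

Lemma twin_inj x x' y' : twin x x' -> twin x y' -> x' = y'.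
Proof. by move=> [_ _ xx' _] [_ _ /(fold_det rhoP rootC xx')[]]. Qed.

Lemma twin_inj' x y x' : twin x x' -> twin y x' -> x = y.
Proof. by move=> [_ _ _ xx'] [_ _ _ /(fold_det rhoP' rootC' xx')[]]. Qed.

Lemma twin_step x x' a y : twin x x' -> E x a y -> C y ->
  exists2 y', E x' a y' & twin y y'.
Proof.
move=> tx xy Cy; have [Cx C'x' fx fx'] := tx.
have [[z|y'] fy] := fold_edge rhoP rootC fx xy; last first.
  case=> x'y' _ C'y'; exists y' => //; split=> //.
  (* The swapped gluing keeps the edge from [x] to [y] in its right copy, so determinism forces the
     image of [y'] there to be [y]. *)
  have [q fy' x'q] := fold_edge rhoP' rootC' fx' x'y'.
  suff -> : inr y = q by [].
  apply: (glue_edge_det detE symE rhoP' _ x'q).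
  by split.
(* The image edge cannot leave through the seam: the partner [x0] of [x'] would be [x], and
   determinism would put [y] outside [C]. *)
case=> x0 [x0z Cx0 nCz rx0].
have xx := twin_inj' tx (rho_twin Cx0 rx0); rewrite -xx in x0z.
by case: nCz; rewrite (detE x0z xy).
Qed.

(** Partners are twins inside [C] and [rho]-partners outside, where the path is in the collar. At a
    crossing edge both ends are in the collar, and there the two relations agree. *)
Lemma lockstep x x' u y : path_in E (fun z => C z \/ near E C N z) x u y ->
  C x /\ twin x x' \/ ~ C x /\ rho x x' ->
  exists2 y', C y /\ twin y y' \/ ~ C y /\ rho y y' &
    path_in E (fun z => C' z \/ near E C' N z) x' u y'.
Proof.
have reg z z' : C z /\ twin z z' \/ ~ C z /\ rho z z' -> C' z' \/ near E C' N z'.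
  by case=> [[_ []]|[_ /(rho_near rhoP)[]]]; [left|right].
elim: u x x' => [|a u IHu] x x' /= [xX].
  by move=> <- xx'; exists x' => //; split=> //; exact: reg xx'.
case=> z xz zy xx'.
suff [z' x'z' zz'] : exists2 z', E x' a z' & C z /\ twin z z' \/ ~ C z /\ rho z z'.
  have [y' yy' zy'] := IHu _ _ zy zz'; exists y' => //; split; first exact: reg xx'.
  by exists z'.
have [zX _] := path_in_ends zy.
have [Cz|nCz] := pselect (C z); case: xx' => -[Cx tx].
- by have [z' xz' tz] := twin_step tx xz Cz; exists z' => //; left.
- have [_ [z' rz]] : (exists x', rho x x') /\ exists z', rho z z'.
    by apply: (crossing_rho symE rhoP xz); case=> _ /(_ Cz).
  exists z'; first exact/(rho_edge rhoP a tx rz).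
  by left; split=> //; exact: rho_twin.
- have [[x'' rx] [z' rz]] : (exists x', rho x x') /\ exists z', rho z z'.
    by apply: (crossing_rho symE rhoP xz); case=> /(_ Cx).
  have xx := twin_inj tx (rho_twin Cx rx); rewrite -xx in rx.
  exists z'; first exact/(rho_edge rhoP a rx rz).
  by right.
case: zX => // /(rho_dom rhoP)[z' rz].
by exists z'; [exact/(rho_edge rhoP a tx rz)|right].
Qed.

Lemma region_transfer (p p' q q' : V) u : rho p p' -> rho q q' ->
  path_in E (fun z => C z \/ near E C N z) p u q ->
  path_in E (fun z => C' z \/ near E C' N z) p' u q'.
Proof.
move=> rp rq pq.
have [|y' yy' py'] := lockstep (x' := p') pq.
  by have [Cp|] := pselect (C p); [left; split=> //; exact: rho_twin | right].
suff -> : q' = y' by [].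
case: yy' => -[Cq].
  exact/twin_inj/rho_twin.
by move=> rq'; exact/(rho_inj rhoP rq rq').
Qed.

End Lockstep.

Definition region_language C (p q : V) : set (word A) :=
  [set u | path_in E (fun z => C z \/ near E C N z) p u q]%classic.

Lemma eq_region_language C C' rho (p p' q q' : V) :
  matching E N C C' rho -> rooted C -> rooted C' -> rho p p' -> rho q q' ->
  region_language C p q = region_language C' p' q'.
Proof.
move=> rhoP rootC rootC' rp rq; apply/seteqP; split=> u.
  exact (region_transfer rhoP rootC rootC' rp rq).
exact (region_transfer (matching_sym rhoP) rootC' rootC rp rq).
Qed.

End Transfer.

(** * Context-freeness from finitely many splittable languages *)

Section Splitting.
Variables (L N : finType) (h : N -> set (seq L)) (start : N).
Implicit Types (i j k : N) (u v : seq L) (g : seq N).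

Lemma In_mem (T : eqType) (x : T) s : List.In x s <-> x \in s.
Proof.
elim: s => [|y s IHs] //=; rewrite inE; split=> [[->|/IHs->]|/predU1P[->|/IHs]].
- by rewrite eqxx.
- by rewrite orbT.
- by left.
- by right.
Qed.

(* States: [None] is initial, [Some false] simulates the grammar with
   nonterminals [N], [Some true] accepts. Stack symbol [None] is the bottom. *)
Definition split_transition :=
  (option bool * option L * option N * option bool * seq (option N))%type.

Definition branch_trans (t : N * N * N) : split_transition :=
  let: (i, j, k) := t in
  (Some false, None, Some i, Some false, [:: Some j; Some k]).

Definition letter_trans (t : N * L) : split_transition :=
  (Some false, Some t.2, Some t.1, Some false, [::]).

Definition empty_trans i : split_transition :=
  (Some false, None, Some i, Some false, [::]).

(** Productions are chosen semantically: [i] may be replaced by [j] and [k] whenever this is sound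
    for the languages [h]. *)
Definition branches (t : N * N * N) : Prop :=
  let: (i, j, k) := t in forall u v, h j u -> h k v -> h i (u ++ v).

Definition split_trans : seq split_transition :=
  [:: (None, None, None, Some false, [:: Some start; None]);
      (Some false, None, None, Some true, [::])]
  ++ [seq branch_trans t | t <- enum {: N * N * N} & `[< branches t >]]
  ++ [seq letter_trans t | t <- enum {: N * L} & `[< h t.1 [:: t.2] >]]
  ++ [seq empty_trans i | i <- enum N & `[< h i [::] >]].

Definition split_pda : pda L :=
  @Pda L (option bool) (option N) split_trans None None (pred1 (Some true)).

Fixpoint derives g u : Prop :=
  if g is i :: g' then exists u1 u2, [/\ u = u1 ++ u2, h i u1 & derives g' u2]
  else u = [::].

Definition stack_of g : seq (option N) := map some g ++ [:: None].

(** An invariant of the configurations from which the automaton accepts. In the accepting state it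
    says that once the bottom symbol is gone and the stack is empty, no input is left. *)
Definition accepts_from (q : option bool) u (s : seq (option N)) : Prop :=
  match q with
  | None => s = [:: None] -> h start u
  | Some false => forall g, s = stack_of g -> derives g u
  | Some true => u = [::] \/ s <> [::]
  end.

Lemma split_pda_sound (c d : pda_config split_pda) :
  pda_run c d -> d.1 = (Some true, [::]) -> accepts_from c.1.1 c.1.2 c.2.
Proof.
elim=> {c d} [[[q u] s] [-> ->]|q u Z s q' g d qq' _ IH dE
  |q a u Z s q' g d qq' _ IH dE]; first by left.
- have {IH} /= := IH dE; move/In_mem: qq'; rewrite /= !inE !mem_cat.
  case/or4P=> [/eqP[-> -> -> ->]|/eqP[-> -> -> ->]||].
  + move=> IH [s0]; have [|u1 [u2 [-> hu1 ->]]] := IH [:: start]; first by rewrite s0.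
    by rewrite cats0.
  + by move=> /= us [|i g'] //= [s0]; case: us.
  + case/mapP=> -[[i j] k]; rewrite mem_filter => /andP[/asboolP br _] [-> -> -> ->] /= IH.
    case=> [|_ g'] //= [<- sE].
    have [|u1 [_ [-> hu1 [u2 [u3 [-> hu2 hu3]]]]]] := IH [:: j, k & g'].
      by rewrite sE.
    by exists (u1 ++ u2), u3; rewrite catA; split=> //; exact: br.
  case/orP=> /mapP[t]; rewrite mem_filter => /andP[/asboolP ht _] //.
  case=> -> -> -> -> /= IH [|_ g'] //= [<- sE].
  by exists [::], u; split=> //; exact: IH.
have {IH} /= := IH dE; move/In_mem: qq'; rewrite /= !inE !mem_cat /=.
case/or4P=> [/eqP//|/eqP//|/mapP[[[i j] k] _]//|].
case/orP=> /mapP[t]; rewrite mem_filter => /andP[/asboolP ht _] //.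
case=> -> -> -> -> -> /= IH [|_ g'] //= [<- sE].
by exists [:: t.2], u; split=> //; exact: IH.
Qed.

Hypothesis splitP : forall i u, h i u -> 2 <= size u ->
  exists u1 u2 j k, [/\ u = u1 ++ u2, u1 != [::], u2 != [::], h j u1 /\ h k u2
    & forall v1 v2, h j v1 -> h k v2 -> h i (v1 ++ v2)].

(** Induction on the length: a word with at least two letters splits into two nonempty, hence
    shorter, factors; the others are consumed in one transition. *)
Lemma split_pda_pop i u v s (d : pda_config split_pda) : h i u ->
  pda_run (P := split_pda) (Some false, v, s) d ->
  pda_run (P := split_pda) (Some false, u ++ v, Some i :: s) d.
Proof.
have [n] := ubnP (size u); elim: n i u v s => // n IHn i u v s.
rewrite ltnS => un hu run.
have [u2|] := leqP 2 (size u).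
  have [u1 [{}u2 [j [k [uE nu1 nu2 [hu1 hu2] br]]]]] := splitP hu u2.
  rewrite uE -catA; move: un nu1 nu2; rewrite uE size_cat -!size_eq0 => un nu1 nu2.
  apply: (@PdaEps L split_pda _ _ (Some i) _ (Some false) [:: Some j; Some k]).
    apply/In_mem; rewrite !mem_cat; apply/or4P/Or42/mapP; exists (i, j, k) => //.
    by rewrite mem_filter mem_enum andbT; apply/asboolP.
  apply: (IHn) => //; first by rewrite (leq_trans _ un) // -addn1 leq_add2l lt0n.
  by apply: IHn => //; rewrite (leq_trans _ un) // -addn1 addnC leq_add2r lt0n.
case: u hu {un} => [|a [|//]] hu _.
  apply: (@PdaEps L split_pda _ _ (Some i) _ (Some false) [::]) => //.
  apply/In_mem; rewrite !mem_cat; apply/or4P/Or44/mapP; exists i => //.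
  by rewrite mem_filter mem_enum andbT; apply/asboolP.
apply: (@PdaRead L split_pda _ _ _ (Some i) _ (Some false) [::]) => //.
apply/In_mem; rewrite !mem_cat; apply/or4P/Or43/mapP; exists (i, a) => //.
by rewrite mem_filter mem_enum andbT; apply/asboolP.
Qed.

Lemma context_free_split : context_free (h start).
Proof.
exists split_pda; apply/seteqP; split=> u.
  move=> hu; exists (Some true); first exact: eqxx.
  exists [::]; apply: (@PdaEps L split_pda _ _ None _ (Some false) [:: Some start; None]).
    by left.
  rewrite -[u]cats0; apply: split_pda_pop => //.
  apply: (@PdaEps L split_pda _ _ None _ (Some true) [::]); first by right; left.
  exact: PdaStop.
case=> q /eqP-> [s /split_pda_sound]; exact.
Qed.

End Splitting.

(** * Trees and quasi-trees *)

Section Dist.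
Variables (V : eqType) (e : rel V).

Lemma dist_le x p : path e x p -> dist e x (last x p) <= size p.
Proof.
move=> ep; rewrite /dist; case: pselect => [h|[]]; last first.
  by exists (size p); apply/asboolP; exists p.
by case: ex_minnP => m _; apply; apply/asboolP; exists p.
Qed.

Lemma dist_path x y : connected_graph e ->
  exists p, [/\ path e x p, last x p = y & size p = dist e x y].
Proof.
move=> /(_ x y)[p ep py]; rewrite /dist; case: pselect => [h|[]]; last first.
  by exists (size p); apply/asboolP; exists p.
by case: ex_minnP => m /asboolP[q] ? _; exists q.
Qed.

Lemma dist_prefix x p v : path e x p -> v \in x :: p -> dist e x v <= size p.
Proof.
move=> + vp; case/splitPl: vp => p1 p2 <-; rewrite cat_path => /andP[xp1 _].
by apply: leq_trans (dist_le xp1) _; rewrite size_cat leq_addr.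
Qed.

End Dist.

Definition separates (T : eqType) (t : rel T) (c x y : T) : Prop :=
  forall p, path t x p -> last x p = y -> c \in x :: p.

Section Tree.
Variables (T : eqType) (t : rel T).
Hypothesis treeT : is_tree t.
Implicit Types (a b c x y z : T) (p q : seq T).

Let symT : symmetric t. Proof. by case: treeT. Qed.
Let connT : connected_graph t. Proof. by case: treeT. Qed.

Definition avoids c x y : Prop :=
  exists p, [/\ path t x p, last x p = y & c \notin x :: p].

Lemma avoids_sym c x y : avoids c x y -> avoids c y x.
Proof.
move=> [p [xp <- cp]]; exists (rev (belast x p)); split.
- by rewrite rev_path (eq_path (e' := t)) // => ? ?; rewrite symT.
- by case: p {xp cp} => //= z p; rewrite rev_cons last_rcons.
by rewrite -rev_rcons -lastI mem_rev.
Qed.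

Lemma avoids_trans c x y z : avoids c x y -> avoids c y z -> avoids c x z.
Proof.
move=> [p [xp <- cp]] [q [yq <- cq]]; exists (p ++ q); split.
- by rewrite cat_path xp.
- by rewrite last_cat.
rewrite -cat_cons mem_cat negb_or cp; move: cq; rewrite inE negb_or => /andP[_ ->//].
Qed.

(** Otherwise a simple path from [a] to [b] avoiding [c] closes up through [c] to a cycle of length
    at least 3. *)
Lemma tree_neighbours a b c : t c a -> t c b -> avoids c a b -> a = b.
Proof.
move=> ca cb [p [+ + cp]]; case/shortenP => q aq uq qp qb.
have cq : c \notin a :: q.
  by move: cp; rewrite !inE !negb_or => /andP[-> cp]; exact: contra (@qp c) cp.
have uc : ucycle t [:: c, a & q].
  rewrite /ucycle cons_uniq cq uq andbT /= rcons_path ca aq /= qb.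
  by rewrite symT cb.
have [_ _ _ _ /(_ _ uc)] := treeT.
by case: q qb {aq uq qp cq uc}.
Qed.

(** If some path avoided [c], the two neighbours of [c] on the simple path could be joined without
    [c], hence would coincide. *)
Lemma simple_separates x p c :
  path t x p -> uniq (x :: p) -> c \in x :: p -> separates t c x (last x p).
Proof.
move=> xp up cp q xq qp; apply: contraT => cq.
have : avoids c x (last x p) by exists q.
have xc : x != c by apply: contraNneq cq => <-; exact: mem_head.
have lc : last x p != c by apply: contraNneq cq => <-; rewrite -qp mem_last.
move: cp; rewrite inE eq_sym (negPf xc) /= => cp.
case/splitPr: cp xp up lc {qp} => p1 [|b p2].
  by rewrite last_cat /= eqxx.
rewrite cat_path last_cat -cat_cons cat_uniq => /andP[xp1 /and3P[ac cb bp2]].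
case/and3P=> _ /hasPn dis /and3P[cb2 _ _] _ av.
have cp1 := dis _ (mem_head _ _).
have bp1 : b \notin x :: p1 by apply: dis; rewrite !inE eqxx orbT.
have ca : avoids c (last x p1) (last b p2).
  by apply: avoids_trans av; apply: avoids_sym; exists p1.
have /(avoids_trans ca) : avoids c (last b p2) b by apply: avoids_sym; exists p2.
move=> /tree_neighbours; rewrite symT => /(_ ac cb) ab.
by rewrite -ab mem_last in bp1.
Qed.

(** Take for [c] the first vertex of the simple path from [x] to [y] that lies on the simple path
    from [y] to [z]. Switching paths at [c] gives a simple path from [x] to [z]. *)
Lemma tripod x y z : exists c,
  [/\ separates t c x y, separates t c y z & separates t c x z].
Proof.
have [p0 + +] := connT y z; case/shortenP => p yp up _ pz {p0}.
have [r0 + +] := connT x y; case/shortenP => r xr ur _ ry {r0}.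
have : has (mem (y :: p)) (x :: r).
  by apply/hasP; exists y; [rewrite -ry mem_last | exact: mem_head].
move E : (x :: r) => s hs; case: (split_find hs) E => {s hs} c r1 r2 cp r1p E.
exists c; have cr : c \in x :: r by rewrite E mem_cat mem_rcons mem_head.
split; first by rewrite -ry; exact: simple_separates.
  by rewrite -pz; exact: simple_separates.
have [p2 [cp2 ucp2 sp lp]] : exists p2, [/\ path t c p2, uniq (c :: p2),
    {subset p2 <= y :: p} & last c p2 = z].
  have {}cp : c \in y :: p by [].
  move: cp yp up pz; rewrite inE => /predU1P[->|]; first by
    exists p; split=> // u hu; rewrite inE hu orbT.
  case/splitPr=> p1 p2; rewrite cat_path last_cat => /and3P[_ _ cp2].
  rewrite -cat_cons cat_uniq => /and3P[_ _ up2] lp; exists p2; split=> // u hu.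
  by rewrite !inE mem_cat inE hu !orbT.
case: r1 r1p E => [|x' r1] r1p /=; first by case=> -> _ q _ _; exact: mem_head.
case=> xx rE; rewrite -{x'}xx in r1p *; move: xr ur; rewrite rE cat_path rcons_path.
case/andP=> /andP[xr1 r1c] _; rewrite -cat_cons cat_uniq -rcons_cons rcons_uniq.
case/andP=> /andP[cr1 ur1] _.
have -> : z = last x (r1 ++ c :: p2) by rewrite last_cat.
apply: simple_separates.
- by rewrite cat_path xr1 /= r1c.
- rewrite -cat_cons cat_uniq ur1 ucp2 andbT /= negb_or cr1 /=.
  apply: contra r1p => /hasP[u up2 ur]; apply/hasP; exists u => //.
  exact: sp.
by rewrite inE mem_cat mem_head !orbT.
Qed.

End Tree.

(** * Coarse images of paths in a tree *)

Section Coarse.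
Variables (T : eqType) (t : rel T).
Hypothesis connT : connected_graph t.
Variables (L V : Type) (E : V -> L -> V -> Prop) (f : V -> T) (B : nat).
Hypothesis fE : forall (x : V) (a : L) (y : V), E x a y -> dist t (f x) (f y) <= B.

(** Geodesics between the images of consecutive vertices form a path, which meets [c]; the geodesic
    containing [c] has length at most [B]. *)
Lemma coarse_separates Q (x : V) u (y : V) c : path_in E Q x u y ->
  separates t c (f x) (f y) ->
  exists u1 u2 z, [/\ u = u1 ++ u2, path_in E Q x u1 z, path_in E Q z u2 y
    & dist t (f z) c <= B].
Proof.
move=> xy; suff [q [xq qy qP]] : exists q, [/\ path t (f x) q, last (f x) q = f y &
    forall v, v \in f x :: q -> exists u1 u2 z, [/\ u = u1 ++ u2,
      path_in E Q x u1 z, path_in E Q z u2 y & dist t (f z) v <= B]].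
  by move=> /(_ q xq qy); exact: qP.
elim: u x xy => [|a u IHu] x /= [Qx].
  move=> <-; exists [::]; split=> // v; rewrite inE => /eqP->.
  by exists [::], [::], x; split=> //; exact: leq_trans (@dist_le _ t (f x) [::] isT) _.
case=> z xz zy; have [q [zq qy qP]] := IHu _ zy.
have [p [xp pz ps]] := dist_path (f x) (f z) connT.
exists (p ++ q); split; rewrite ?cat_path ?xp ?last_cat ?pz // => v.
rewrite -cat_cons mem_cat => /orP[vp|vq].
  exists [::], (a :: u), x; split=> //; first by split=> //; exists z.
  by apply: leq_trans (dist_prefix xp vp) _; rewrite ps; exact: fE xz.
have [|u1 [u2 [s [-> zs sy sv]]]] := qP v; first by rewrite inE vq orbT.
by exists (a :: u1), u2, s; split=> //; split=> //; exists z.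
Qed.

End Coarse.

Section QuasiIsometryBounds.
Import GRing.Theory Num.Theory Order.TTheory.
Local Open Scope ring_scope.

Lemma quasi_isometric_nat (X Y : Type) (dX : X -> X -> nat) (dY : Y -> Y -> nat) :
  quasi_isometric dX dY -> exists (f : X -> Y) (K : nat), forall x x',
    (dX x x' <= K * dY (f x) (f x') + K /\ dY (f x) (f x') <= K * dX x x' + K)%N.
Proof.
move=> [f [k [c [k1 c0 fP _]]]].
have k0 : 0 <= k by exact: le_trans k1.
have kc0 : 0 <= k * c by exact: mulr_ge0.
have [hk hc hkc] := And3 (archi_boundP k0) (archi_boundP c0) (archi_boundP kc0).
set a := Num.bound k in hk; set b := Num.bound c in hc; set d := Num.bound _ in hkc.
(* The constant dominates [k], [c] and [k * c]; the product arises on multiplying the lower bound by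
   [k]. *)
exists f, (a + b + d)%N => x x'; have /andP[h1 h2] := fP x x'.
have dX0 : 0 <= (dX x x')%:R :> Rdefinitions.R by exact: ler0n.
have dY0 : 0 <= (dY (f x) (f x'))%:R :> Rdefinitions.R by exact: ler0n.
have a0 : 0 <= a%:R :> Rdefinitions.R by exact: ler0n.
have b0 : 0 <= b%:R :> Rdefinitions.R by exact: ler0n.
have d0 : 0 <= d%:R :> Rdefinitions.R by exact: ler0n.
have kpos : 0 < k by exact: lt_le_trans k1.
split; rewrite -(ler_nat Rdefinitions.R) natrD natrM !natrD.
  have : (dX x x')%:R <= k * (dY (f x) (f x'))%:R + k * c.
    move: h1; rewrite lerBlDr -(ler_pM2l kpos) mulrA divff ?gt_eqF // mul1r.
    by rewrite mulrDr.
  nra.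
nra.
Qed.

End QuasiIsometryBounds.

(** * Distances from a base vertex *)

Section Levels.
Variables (A : finType) (V : eqType) (E : V -> letter A -> V -> Prop) (e : rel V).
Hypotheses (symE : involutive_graph E).
Hypothesis eE : forall x y, e x y <-> exists a, E x a y.
Hypothesis conn : connected_graph e.
Implicit Types (x y z : V) (u v : word A).

Lemma reads_dist x u y : reads E x u y -> dist e x y <= size u.
Proof.
move=> xy; have [p [xp <- <-]] :
    exists p, [/\ path e x p, last x p = y & size p = size u].
  elim: u x xy => [|a u IHu] x /= [_]; first by exists [::].
  case=> z xz /IHu[p [zp yp <-]]; exists (z :: p) => /=; split=> //.
  by rewrite zp andbT; apply/eE; exists a.
exact: dist_le.
Qed.

Lemma dist_reads x y : exists2 u, reads E x u y & size u = dist e x y.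
Proof.
have [p [xp <- <-]] := dist_path x y conn.
elim: p x xp => [|z p IHp] x /=; first by exists [::].
case/andP=> /eE[a xz] /IHp[u zu <-]; exists (a :: u) => //; split=> //.
by exists z.
Qed.

Lemma dist_triangle x y z : dist e x z <= dist e x y + dist e y z.
Proof.
have [u xy <-] := dist_reads x y; have [v yz <-] := dist_reads y z.
by rewrite -size_cat; apply: reads_dist; apply/path_in_cat; exists y.
Qed.

Lemma dist_sym x y : dist e x y = dist e y x.
Proof.
suff h z t : dist e z t <= dist e t z by apply/eqP; rewrite eqn_leq !h.
have [u tz <-] := dist_reads t z.
have := reads_dist (path_in_inv symE tz).
by rewrite /inv_word size_rev size_map.
Qed.

Lemma dist_edge o x a y : E x a y -> dist e o y <= (dist e o x).+1.
Proof.
move=> xy; apply: leq_trans (dist_triangle o x y) _; rewrite -addn1 leq_add2l.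
by apply: (@reads_dist x [:: a]); split=> //; exists y.
Qed.

(* A path staying at distance at least [k] from [o] passes, up to a bounded
   distance, through the centre of the tripod spanned by its ends and [o], and
   so do the geodesics from [o] to its ends: the centre is close to both ends. *)
Lemma level_bound : tree_like e -> exists D, forall o k x u y,
  dist e o x = k -> dist e o y = k ->
  path_in E (fun z => k <= dist e o z) x u y -> dist e x y <= D.
Proof.
move=> [T [t [treeT /quasi_isometric_nat[f [K fK]]]]].
have connT : connected_graph t by case: treeT.
have fE x a y : E x a y -> dist t (f x) (f y) <= K + K.
  move=> xy; apply: leq_trans (fK x y).2 _; rewrite leq_add2r -[leqRHS]muln1 leq_mul2l.
  by rewrite (@reads_dist x [:: a]) ?orbT //; split=> //; exists y.
have symT : symmetric t by case: treeT.
(* [B] bounds the image of an edge, and [J] the distance of two vertices whose images are within [B]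
   of a common point. *)
pose B := K + K; pose J := K * (B + B) + K.
have close c p q : dist t (f p) c <= B -> dist t (f q) c <= B -> dist e p q <= J.
  move=> pc qc; apply: leq_trans (fK p q).1 _; rewrite leq_add2r leq_mul2l; apply/orP; right.
  have [r [pr rc rs]] := dist_path (f p) c connT.
  have [s [qs sc ss]] := dist_path (f q) c connT.
  have cq : path t c (rev (belast (f q) s)).
    by rewrite -{1}sc rev_path (eq_path (e' := t)) // => ? ?; rewrite symT.
  have lq : last c (rev (belast (f q) s)) = f q.
    by case: (s) sc => //= z s' _; rewrite rev_cons last_rcons.
  have /dist_le : path t (f p) (r ++ rev (belast (f q) s)) by rewrite cat_path pr rc.
  rewrite last_cat rc lq size_cat size_rev size_belast rs ss => h.
  exact: leq_trans h (leq_add pc qc).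
(* As [m] has level at least [k], the points [a] and [b] on the geodesics have level at least
   [k - J], hence lie within [J] of [x] and [y]; the third [J] bounds the distance from [a] to
   [b]. *)
exists (J + J + J) => o k x u y ox oy xy.
have [c [c1 c2 c3]] := tripod treeT (f o) (f x) (f y).
have [u1 oux su1] := dist_reads o x; have [u2 ouy su2] := dist_reads o y.
have [p1 [p2 [a [pE oa ax ac]]]] := coarse_separates connT fE oux c1.
have [v1 [v2 [m [_ xm _ mc]]]] := coarse_separates connT fE xy c2.
have [q1 [q2 [b [qE ob bY bc]]]] := coarse_separates connT fE ouy c3.
have [_ km] := path_in_ends xm.
have am := close _ _ _ ac mc; have bm := close _ _ _ bc mc; have ab := close _ _ _ ac bc.
have := dist_triangle o a m; have := dist_triangle o b m.
have := dist_triangle x a y; have := dist_triangle a b y.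
have := reads_dist oa; have := reads_dist ob; have := reads_dist ax; have := reads_dist bY.
rewrite (dist_sym x a); move: su1 su2; rewrite pE qE !size_cat; lia.
Qed.

End Levels.

(** * Cones *)

Section Cones.
Variables (A : finType) (V : eqType) (E : V -> letter A -> V -> Prop) (e : rel V).
Hypotheses (detE : deterministic E) (symE : involutive_graph E).
Hypothesis eE : forall x y, e x y <-> exists a, E x a y.
Hypothesis conn : connected_graph e.
Variable o : V.
Implicit Types (x y z : V) (u v : word A).

Let lev x := dist e o x.

Definition cone k c x : Prop := exists u, path_in E (fun z => k <= lev z) c u x.

Lemma cone_level k c x : cone k c x -> k <= lev x.
Proof. by move=> [u cx]; have [] := path_in_ends cx. Qed.

Lemma cone_apex k c : k <= lev c -> cone k c c.
Proof. by exists [::]. Qed.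

Lemma cone_edge k c x a y : cone k c x -> E x a y -> k <= lev y -> cone k c y.
Proof. by move=> [u cx] xy ky; exists (rcons u a); exact: path_in_rcons cx xy ky. Qed.

Lemma cone_path k c x u y : cone k c x -> path_in E (fun z => k <= lev z) x u y ->
  path_in E (cone k c) x u y.
Proof.
elim: u x => [|a u IHu] x cx /= [_]; first by move=> <-.
case=> z xz zy; split=> //; exists z => //; apply: IHu => //.
by apply: cone_edge cx xz _; have [] := path_in_ends zy.
Qed.

Lemma level_edge x a y : E x a y -> lev y <= (lev x).+1.
Proof. exact: dist_edge. Qed.

Lemma level_edge' x a y : E x a y -> lev x <= (lev y).+1.
Proof. by move=> /symE; exact: level_edge. Qed.

Lemma level_path x u y : reads E x u y -> lev y <= lev x + size u.
Proof.
elim: u x => [|a u IHu] x /= [_]; first by move=> ->; rewrite addn0.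
by case=> z /level_edge xz /IHu zy; lia.
Qed.

Lemma level_pred x : 0 < lev x -> exists y a, E y a x /\ (lev y).+1 = lev x.
Proof.
have [u ox uE] := dist_reads eE conn o x; rewrite {1}/lev -uE.
case/lastP: u ox uE => // u a ox uE _.
move: ox; rewrite -cats1 => /path_in_cat[y oy [_ [z yx [_ zx]]]].
rewrite zx in yx; exists y, a; split=> //.
have := level_edge yx; have := reads_dist eE oy.
by move: uE; rewrite size_rcons -/(lev x) -/(lev y); lia.
Qed.

Lemma level0 x : lev x = 0 -> x = o.
Proof. by have [[|a u] [_ /= ox] uE] := dist_reads eE conn o x; rewrite /lev -uE. Qed.

Lemma cone_leave k c x a y : cone k c x -> ~ cone k c y -> E x a y ->
  lev x = k /\ lev y < k.
Proof.
move=> cx ncy xy; have yk : lev y < k.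
  by rewrite ltnNge; apply/negP => ky; apply: ncy; exact: cone_edge cx xy ky.
have := level_edge' xy; have := cone_level cx; split=> //; lia.
Qed.

Lemma crossing_level k c x : crossing E (cone k c) x -> lev x <= k.
Proof.
move=> [a [y [xy nC]]]; have [cx|ncx] := pselect (cone k c x).
  have [|-> //] := cone_leave cx _ xy; move=> cy; exact: nC.
have cy : cone k c y by apply: contrapT => ncy; apply: nC.
by have [_ /ltnW] := cone_leave cy ncx (symE xy).
Qed.

Lemma near_level k c j x : near E (cone k c) j x -> lev x <= k + j.
Proof.
move=> [b [u [uj /crossing_level bk /level_path]]]; lia.
Qed.

(** Descending towards [o] stays in the cone down to level [k], whose vertices have a predecessor
    outside because [k] is positive. Contraposed, cone vertices off the collar have level above
    [k + N]. *)
Lemma cone_near k c x : 0 < k -> cone k c x -> near E (cone k c) (lev x - k) x.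
Proof.
move=> k0; move En : (lev x - k) => n; elim: n x En => [|n IHn] x En cx;
    have xk := cone_level cx;
    have [|y [a [yx yE]]] := @level_pred x; rewrite ?(leq_trans k0) //.
  apply: crossing_near; exists (inv_letter a), y; split; first exact: symE.
  by case=> /(_ cx)/cone_level; lia.
have cy : cone k c y by apply: cone_edge cx (symE yx) _; lia.
by apply: near_edge yx; apply: IHn => //; lia.
Qed.

Lemma path_below k x u y : reads E x u y -> lev x + size u < k ->
  path_in E (fun z => lev z < k) x u y.
Proof.
elim: u x => [|a u IHu] x /= [_]; first by move=> <-; rewrite addn0.
case=> z xz zy uk; split; first lia.
by exists z => //; apply: IHu => //; have := level_edge xz; lia.
Qed.

(** The path of [w] is too short to reach level [k]. A predecessor of a vertex outside the cone is
    also outside, since a step upwards from the cone remains in it. *)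
Lemma cone_rooted w f k c : reads E o w f -> size w < k -> rooted E o w (cone k c).
Proof.
move=> of_ wk; split.
  exists f; apply: (@path_in_sub _ _ _ (fun z => lev z < k)).
    by move=> z zk /cone_level; rewrite leqNgt zk.
  apply: path_below => //; suff -> : lev o = 0 by [].
  by apply/eqP; rewrite -leqn0; exact: (@dist_le _ e o [::] isT).
move=> x; move En : (lev x) => n; elim: n x En => [|n IHn] x En ncx.
  by rewrite -(level0 En); exists [::]; split=> //; rewrite (level0 En).
have [|y [a [yx yE]]] := @level_pred x; first by rewrite En.
have [cy|ncy] := pselect (cone k c y).
  by case: ncx; apply: (cone_edge cy yx); have := cone_level cy; lia.
have [|u oy] := IHn y _ ncy; first lia.
by exists (rcons u a); exact: path_in_rcons oy yx ncx.
Qed.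

Lemma region_nested N k c k1 c1 : k + N < k1 -> cone k c c1 ->
  forall y, cone k1 c1 y \/ near E (cone k1 c1) N y ->
  cone k c y \/ near E (cone k c) N y.
Proof.
move=> kk cc1; have sub y : cone k1 c1 y -> cone k c y.
  move=> [u yu]; have : path_in E (fun z => k <= lev z) c1 u y.
    by apply: path_in_sub yu => z; lia.
  by move=> /(cone_path cc1) cy; have [] := path_in_ends cy.
move=> y [/sub|]; first by left.
case=> b [u [uN [a [z [bz nC]]] bY]].
(* The boundary vertex [b] has level at least [k1 - 1], so it is in the larger cone; at most [N]
   steps from it stay there or in the collar of that cone. *)
have cb : cone k c b.
  have [cb|ncb] := pselect (cone k1 c1 b); first exact: sub.
  have cz : cone k1 c1 z by apply: contrapT => ncz; apply: nC.
  apply: cone_edge (sub _ cz) (symE bz) _.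
  by have := cone_level cz; have := level_edge bz; lia.
have [side|nr] := side_or_near symE (cone k c) bY.
  by left; have [_ h] := path_in_ends side; exact/h.
by right; have [_] := path_in_ends nr; exact: near_leq.
Qed.

(** Determinism bounds the degree by the number of letters, so the bound does not depend on the
    centre. *)
Lemma ball_list r : exists n, forall c, exists l : seq V,
  size l <= n /\ forall x, dist e c x <= r -> x \in l.
Proof.
elim: r => [|r [n IHr]].
  exists 1 => c; exists [:: c]; split=> // x.
  have [[|a u] + <-] := dist_reads eE conn c x => //= -[_ ->] _.
  exact: mem_head.
exists (n + n * #|{: letter A}|) => c; have [l [ln lP]] := IHr c.
pose next x a := if pselect (exists y, E x a y) is left h then projT1 (cid h) else x.
exists (l ++ [seq next x a | x <- l, a <- enum {: letter A}]); split.
  by rewrite size_cat size_allpairs -cardE leq_add // leq_mul2r ln orbT.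
move=> x; rewrite leq_eqVlt ltnS => /orP[/eqP cx|/lP xl]; last by rewrite mem_cat xl.
have [u cux uE] := dist_reads eE conn c x; rewrite cx in uE.
case/lastP: u cux uE => // u a; rewrite size_rcons -cats1 => cux [uE].
have [y cy [_ [z yz [_ zx]]]] := (path_in_cat _ _ _ _ _ _).1 cux; rewrite zx in yz.
rewrite mem_cat; apply/orP; right; apply/allpairsP; exists (y, a); split=> /=.
- by apply: lP; rewrite -uE; exact: reads_dist cy.
- by rewrite mem_enum.
rewrite /next; case: pselect => [h|[]]; last by exists x.
by case: cid => t /= yt; exact: detE yz yt.
Qed.

Lemma collar_list N : tree_like e -> exists n, forall k c, lev c = k ->
  exists s : seq V, [/\ uniq s, size s <= n
    & forall x, x \in s <-> near E (cone k c) N x].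
Proof.
(* Boundary vertices inside the cone are within [D] of the apex, those outside within [D.+1], and
   the collar adds [N]. *)
move=> /(level_bound symE eE conn)[D DP]; have [n nP] := ball_list (D.+1 + N).
exists n => k c ck; have [l [ln lP]] := nP c.
exists (undup [seq x <- l | `[< near E (cone k c) N x >]]); split.
- exact: undup_uniq.
- by apply: leq_trans (size_undup _) _; rewrite size_filter (leq_trans (count_size _ _)).
move=> x; rewrite mem_undup mem_filter; split=> [/andP[/asboolP//]|nx].
apply/andP; split; first exact/asboolP.
apply: lP; have [b [u [uN [a [z [bz nC]]] bx]]] := nx.
have frontier y d t : cone k c y -> ~ cone k c t -> E y d t -> dist e c y <= D.
  move=> [v cy] nct yt; have [yk _] := cone_leave (ex_intro _ v cy) nct yt.
  exact: DP ck yk cy.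
apply: leq_trans (dist_triangle eE conn c b x) _; apply: leq_add; last first.
  exact: leq_trans (reads_dist eE bx) uN.
have [cb|ncb] := pselect (cone k c b).
  by apply/leqW/(frontier b a z) => // cz; apply: nC.
have cz : cone k c z by apply: contrapT => ncz; apply: nC.
have := frontier z _ b cz ncb (symE bz).
by have := dist_edge eE conn c (symE bz); lia.
Qed.

End Cones.

(** * The grammar *)

(** Applied with [B] a collar or the ball around [o]: the path can be cut there, or it makes a
    single excursion away from [B] between its first and last letters. *)
Lemma path_in_interior (L V : Type) (E : V -> L -> V -> Prop) (Q B : V -> Prop)
    x u y : path_in E Q x u y -> 2 <= size u ->
  (exists u1 u2 z, [/\ u = u1 ++ u2, u1 <> [::] /\ u2 <> [::],
     path_in E Q x u1 z, path_in E Q z u2 y & B z]) \/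
  (exists a v b x1 y1, [/\ u = a :: rcons v b, E x a x1, E y1 b y
     & path_in E (fun z => Q z /\ ~ B z) x1 v y1]).
Proof.
case: u => // a u [Qx [x1 xx1]]; case/lastP: u => // v b + _.
rewrite -cats1 => /path_in_cat[y1 xy [Qy1 [z yz [Qz zy]]]]; rewrite {}zy in yz Qz.
have by1 : path_in E Q y1 [:: b] y by split=> //; exists y.
suff [[v1 [v2 [t [vE xt ty Bt]]]]|h] :
    (exists v1 v2 t, [/\ v = v1 ++ v2, path_in E Q x1 v1 t, path_in E Q t v2 y1 & B t])
    \/ path_in E (fun z => Q z /\ ~ B z) x1 v y1.
- left; exists (a :: v1), (v2 ++ [:: b]), t; split=> //.
  + by rewrite vE -catA.
  + by split=> //; case: (v2).
  + by split=> //; exists x1.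
  by apply/path_in_cat; exists y1.
- by right; exists a, v, b, x1, y1; rewrite -cats1.
elim: v {xx1} x1 xy => [|c v IHv] x1 /= [Qx1].
  move=> <-; have [Bx1|nBx1] := pselect (B x1); last by right.
  by left; exists [::], [::], x1.
case=> s x1s sy; have [Bx1|nBx1] := pselect (B x1).
  by left; exists [::], (c :: v), x1; split=> //; split=> //; exists s.
have [[v1 [v2 [t [-> st ty Bt]]]]|h] := IHv _ sy.
  by left; exists (c :: v1), v2, t; split=> //; split=> //; exists s.
by right; split=> //; exists s.
Qed.

Section TreeLike.
Variables (A : finType) (R : seq (word A * word A)).
Variables (V : eqType) (E : V -> letter A -> V -> Prop) (e : rel V) (N : nat).
Hypotheses (detE : deterministic E) (symE : involutive_graph E).
Hypothesis relE : forall u v, (u, v) \in R ->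
  forall x y, reads E x u y <-> reads E x v y.
Hypothesis relN : forall u v, (u, v) \in R -> size u + size v <= N.
Hypothesis eE : forall x y, e x y <-> exists a, E x a y.
Hypothesis conn : connected_graph e.
Variables (o f : V) (w : word A).
Hypothesis initE : forall u v x, reads E o u x -> reads E o v x ->
  congr_closure (relator R) (w ++ inv_word w ++ u) (w ++ inv_word w ++ v).
Hypothesis of_ : reads E o w f.
Implicit Types (x y z p q c : V) (u v : word A) (s : seq V) (k n : nat).

Notation cone := (cone E e o).
Notation collar k c := (near E (cone k c) N).

(** A finite code of a collar with at most [n] points: their number, the labelled edges, which
    points are in the cone, and the positions of two chosen points. *)
Definition cone_type n : finType :=
  ('I_n.+1 * {ffun 'I_n.+1 * letter A * 'I_n.+1 -> bool} * {ffun 'I_n.+1 -> bool}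
   * 'I_n.+1 * 'I_n.+1)%type.

Record cone_data := ConeData {
  height : nat; apex : V; points : seq V; source : V; target : V }.

Definition valid n (d : cone_data) : Prop :=
  [/\ size w < height d, uniq (points d) /\ size (points d) <= n,
      forall x, x \in points d <-> collar (height d) (apex d) x,
      source d \in points d & target d \in points d].

Definition type_of n (d : cone_data) : cone_type n :=
  let pt (i : 'I_n.+1) := nth o (points d) i in
  (inord (size (points d)),
   [ffun t => `[< E (pt t.1.1) t.1.2 (pt t.2) >]],
   [ffun i => `[< cone (height d) (apex d) (pt i) >]],
   inord (index (source d) (points d)), inord (index (target d) (points d))).

Definition cone_language (d : cone_data) : set (word A) :=
  region_language E N (cone (height d) (apex d)) (source d) (target d).

Lemma type_of_language n d d' : valid n d -> valid n d' ->
  type_of n d = type_of n d' -> cone_language d = cone_language d'.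
Proof.
case: d d' => [k c s p q] [k' c' s' p' q'] [/= wk [us sn] sP ps qs].
move=> [/= wk' [us' sn'] sP' ps' qs'] [].
have inordE m m' : m <= n -> m' <= n -> inord m = inord m' :> 'I_n.+1 -> m = m'.
  by move=> mn mn' /(congr1 val); rewrite /= !inordK.
have idx r (t : seq V) : size t <= n -> index r t <= n.
  exact/leq_trans/index_size.
move=> /inordE ss /ffunP edgeP /ffunP coneP /inordE pp /inordE qq.
have {}ss := ss sn sn'.
have {}pp := pp (idx _ _ sn) (idx _ _ sn').
have {}qq := qq (idx _ _ sn) (idx _ _ sn').
(* Points of equal index correspond. Only indices below [size s] occur, so the default [o] of [nth]
   is never met. *)
pose rho x x' := exists i, [/\ i < size s, x = nth o s i & x' = nth o s' i].
have rhoI i : i < size s -> rho (nth o s i) (nth o s' i) by move=> si; exists i.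
have lt_n i : i < size s -> i < n.+1 by move=> si; rewrite ltnS (leq_trans (ltnW si)).
have idxs r : r \in s -> index r s < size s by rewrite index_mem.
have rp : rho p p' by have := rhoI _ (idxs _ ps); rewrite nth_index // pp nth_index.
have rq : rho q q' by have := rhoI _ (idxs _ qs); rewrite nth_index // qq nth_index.
have rootk := cone_rooted eE conn c of_ wk.
have rootk' := cone_rooted eE conn c' of_ wk'.
rewrite /cone_language /=.
apply: (eq_region_language detE symE relE relN initE _ rootk rootk' rp rq); split.
- move=> x x' [i [si -> ->]]; split; first by apply/sP; rewrite mem_nth.
    by apply/sP'; rewrite mem_nth -?ss.
  have := coneP (inord i); rewrite !ffunE inordK; last exact: lt_n.
  by move=> h; split=> cx; apply/asboolP; [rewrite -h|rewrite h]; exact/asboolP.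
- move=> x /sP xs; exists (nth o s' (index x s)); exists (index x s).
  by rewrite nth_index ?idxs.
- move=> x' /sP' xs; exists (nth o s (index x' s')); exists (index x' s').
  by rewrite nth_index // ss index_mem.
- move=> x x' y y' [i [si -> ->]] [j [sj -> ->]].
  split=> [/eqP|/eqP]; rewrite nth_uniq -?ss // => /eqP-> //.
move=> x x' y y' a [i [si -> ->]] [j [sj -> ->]].
have := edgeP (inord i, a, inord j); rewrite !ffunE /= !inordK; try exact: lt_n.
by move=> h; split=> xy; apply/asboolP; [rewrite -h|rewrite h]; exact/asboolP.
Qed.

Section Grammar.
Variables (n m : nat) (ball : seq V).
Hypothesis collarP : forall k c, dist e o c = k -> exists s,
  [/\ uniq s, size s <= n & forall x, x \in s <-> collar k c x].
Hypothesis ballP : forall x, x \in ball <-> dist e o x <= size w.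
Hypothesis ball_size : size ball <= m.

(** Cones of height at most [size w] may meet the path of [w], so near [o] pairs of vertices of the
    ball of radius [size w] take the place of cone types. *)
Definition nonterminal : finType := (cone_type n + 'I_m.+1 * 'I_m.+1)%type.

Definition generated (i : nonterminal) : set (word A) :=
  match i with
  | inl t => [set u | exists d, [/\ valid n d, type_of n d = t & cone_language d u]]%classic
  | inr (i, j) => [set u | reads E (nth o ball i) u (nth o ball j)
      /\ nth o ball i \in ball /\ nth o ball j \in ball]%classic
  end.

Lemma generated_cone d : valid n d -> generated (inl (type_of n d)) = cone_language d.
Proof.
move=> vd; apply/seteqP; split=> u; last by exists d.
by move=> [d' [vd' /(type_of_language vd' vd)->]].
Qed.

Definition ball_index x : 'I_m.+1 := inord (index x ball).

Lemma ball_indexK x : x \in ball -> nth o ball (ball_index x) = x.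
Proof.
move=> xb; rewrite inordK ?nth_index // ltnS (leq_trans _ ball_size) //.
exact: index_size.
Qed.

Lemma generated_split i u : generated i u -> 2 <= size u ->
  exists u1 u2 j l, [/\ u = u1 ++ u2, u1 != [::], u2 != [::],
      generated j u1 /\ generated l u2
    & forall v1 v2, generated j v1 -> generated l v2 -> generated i (v1 ++ v2)].
Proof.
(* The first step of an excursion above level [k] ends at level exactly [k], so [y] serves as apex.
   The vertices [x], [y], [t] are all on the boundary, and both factors use the same collar. *)
have boundary k x a y b z v : size w < k ->
    dist e o x < k -> E x a y -> path_in E (fun z => k <= dist e o z) y v z ->
    forall t, E z b t -> dist e o t < k ->
  exists s, [/\ valid n (ConeData k y s x y), valid n (ConeData k y s y t),
    cone_language (ConeData k y s x y) [:: a]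
    & cone_language (ConeData k y s y t) (rcons v b)].
  move=> wk xk xy yz t zt tk.
  have [ky kz] := path_in_ends yz.
  have yk : dist e o y = k.
    by apply/eqP; rewrite eqn_leq ky (leq_trans (dist_edge eE conn o xy)).
  have [s [us sn sP]] := collarP yk.
  have cy : cone k y y by exact: cone_apex.
  have nc x' : dist e o x' < k -> ~ cone k y x'.
    by move=> x'k /cone_level; rewrite leqNgt x'k.
  have cyz := cone_path cy yz; have [_ cz] := path_in_ends cyz.
  have [nx ny] : crossing E (cone k y) x /\ crossing E (cone k y) y.
    by apply: (crossing_sym symE xy) => -[_ /(_ cy)]; exact: nc xk.
  have [_ nt] : crossing E (cone k y) z /\ crossing E (cone k y) t.
    by apply: (crossing_sym symE zt) => -[/(_ cz) ct _]; exact: nc tk ct.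
  have xs : x \in s by apply/sP/crossing_near.
  have ys : y \in s by apply/sP/crossing_near.
  have ts : t \in s by apply/sP/crossing_near.
  exists s; split=> //=.
    split; first by right; exact: crossing_near.
    by exists y => //; split=> //; left.
  apply: path_in_rcons zt _; last by right; exact: crossing_near.
  by apply: path_in_sub cyz => ?; left.
case: i => [t|[i j]].
  case=> d [vd <- du] u2; rewrite generated_cone //.
  case: d vd du => k c s p q [/= wk [us sn] sP ps qs] du.
  have [[u1 [u3 [z [uE [n1 n3] pz zq /sP zs]]]]|] :=
      path_in_interior (collar k c) du u2.
    have v1 : valid n (ConeData k c s p z) by [].
    have v2 : valid n (ConeData k c s z q) by [].
    exists u1, u3, (inl (type_of n (ConeData k c s p z))),
      (inl (type_of n (ConeData k c s z q))).
    rewrite !generated_cone //; split=> //; [exact/eqP|exact/eqP|].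
    by move=> w1 w2 h1 h2; apply/path_in_cat; exists z.
  move=> [a [v [b [x [y [uE px yq xy]]]]]].
  have deep z : (cone k c z \/ collar k c z) /\ ~ collar k c z -> k + N < dist e o z.
    move=> [[cz|//] nz]; rewrite ltnNge; apply/negP => zN; apply: nz.
    apply: near_leq (cone_near symE eE conn (leq_trans _ wk) cz) => //.
    by rewrite leq_subLR.
  have [xin _] := path_in_ends xy.
  have cx : cone k c x by case: xin => -[].
  have [nps nqs] := ((sP p).1 ps, (sP q).1 qs).
  have pl := near_level symE eE conn nps; have ql := near_level symE eE conn nqs.
  have xy' : path_in E (fun z => (k + N).+1 <= dist e o z) x v y by apply: path_in_sub xy.
  (* Collar vertices, in particular [p] and [q], have level at most [k + N], whereas the interior of
     the path is above that level. *)
  have [s' [v1 v2 h1 h2]] := boundary (k + N).+1 p a x b y v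
    (leq_trans wk (leqW (leq_addr _ _))) pl px xy' q yq ql.
  exists [:: a], (rcons v b), (inl (type_of n (ConeData (k + N).+1 x s' p x))),
    (inl (type_of n (ConeData (k + N).+1 x s' x q))).
  rewrite !generated_cone //; split=> //; first by case: (v).
  move=> w1 w2 h3 h4.
  apply: (path_in_sub (region_nested symE eE conn (leqnn _) cx)).
  by apply/path_in_cat; exists x.
case=> ru [ib jb] u2; set p := nth o ball i in ru ib; set q := nth o ball j in ru jb.
have [[u1 [u3 [z [uE [n1 n3] pz zq zb]]]]|] :=
    path_in_interior (fun z => z \in ball) ru u2.
  exists u1, u3, (inr (i, ball_index z)), (inr (ball_index z, j)).
  rewrite /generated /= ball_indexK //; split=> //; [exact/eqP|exact/eqP|].
  by move=> v1 v2 [h1 _] [h2 _]; split=> //; apply/path_in_cat; exists z.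
move=> [a [v [b [x [y [uE px yq xy]]]]]].
have xy' : path_in E (fun z => size w < dist e o z) x v y.
  by apply: path_in_sub xy => z [_ nz]; rewrite ltnNge; apply/negP => /ballP.
have [s' [v1 v2 h1 h2]] := boundary (size w).+1 p a x b y v (leqnn _)
  ((ballP p).1 ib) px xy' q yq ((ballP q).1 jb).
exists [:: a], (rcons v b), (inl (type_of n (ConeData (size w).+1 x s' p x))),
  (inl (type_of n (ConeData (size w).+1 x s' x q))).
rewrite !generated_cone //; split=> //; first by case: (v).
move=> w1 w2 h3 h4; split=> //; apply/path_in_cat; exists x.
  exact: path_in_reads h3.
exact: path_in_reads h4.
Qed.

End Grammar.

Lemma tree_like_context_free : tree_like e ->
  context_free [set u | reads E o u f]%classic.
Proof.
move=> tlE; have [n nP] := collar_list detE symE eE conn o N tlE.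
have [m mP] := ball_list detE eE conn (size w); have [l [lm lP]] := mP o.
pose ball := [seq x <- l | dist e o x <= size w].
have ballP x : x \in ball <-> dist e o x <= size w.
  by rewrite mem_filter; split=> [/andP[]|xw] //; rewrite xw lP.
have ball_size : size ball <= m.
  by rewrite size_filter (leq_trans (count_size _ _)).
have fb : f \in ball by apply/ballP/(reads_dist eE of_).
have ob : o \in ball.
  by apply/ballP/leq_trans; first exact: (@reads_dist _ _ E e eE o [::] o).
have -> : [set u | reads E o u f]%classic =
  @generated n m ball (inr (ball_index m ball o, ball_index m ball f)).
  by apply/seteqP; split=> u /=; rewrite !ball_indexK // => -[].
exact: context_free_split (generated_split nP ballP ball_size).
Qed.

End TreeLike.

(** * Schützenberger graphs *)

Section SchutzenbergerGraph.
Variables (A : finType) (R : seq (word A * word A)) (w : word A).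
Local Open Scope group_scope.

Let E (x : schutz_vertex R w) a y : Prop := schutz_edge x a y.

Lemma lpath_reads x u y : lpath (@schutz_edge A R w) x u y <-> reads E x u y.
Proof.
elim: u x => [|a u IHu] x /=; first by split=> // -[].
by split=> [[z xz /IHu zy]|[_ [z xz /IHu zy]]]; [split=> //|]; exists z.
Qed.

(** Intermediate vertices stay in the strongly connected component: they are reached from [w]
    through [x] and lead back to it through [y]. *)
Lemma reads_schutz x u y : reads E x u y <-> val y = val x * cl R u.
Proof.
elim: u x => [|a u IHu] x; first by rewrite mulg1; split=> [[_ ->]|/val_inj->].
rewrite -cat1s cl_cat mulgA; split=> [[_ [z /eqP xz /IHu->]]|yE]; first by rewrite xz.
have [/asboolP[[s /cayley_lpath xs] _] /asboolP[_ [t /cayley_lpath yt]]] :=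
  (valP x, valP y).
have zP : val x * cl R [:: a] \in scc (@cayley_edge A R) (cl R w).
  apply/asboolP; split.
    by exists (s ++ [:: a]); apply/cayley_lpath; rewrite cl_cat mulgA -xs.
  by exists (u ++ t); apply/cayley_lpath; rewrite cl_cat mulgA -yE.
pose z : schutz_vertex R w :=
  exist (fun x => x \in scc (@cayley_edge A R) (cl R w)) _ zP.
by split=> //; exists z; [exact: eqxx | exact/IHu].
Qed.

Lemma schutz_language u : language (schutz_automaton R w) u <->
  cl R w = cl R (w ++ inv_word w) * cl R u.
Proof. by rewrite /language /= lpath_reads reads_schutz !SubK. Qed.

Lemma natural_leE u v : natural_le (cl R v) (cl R u) <->
  cl R v = cl R (v ++ inv_word v) * cl R u.
Proof.
rewrite cl_cat; have gh := cl_comm R v u; have gv := cl_inv R v; have gv' := cl_inv' R v.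
have hu := cl_inv R u; have hu' := cl_inv' R u; split=> [[e ee vE]|vE].
  have eU : e * (cl R (inv_word u) * cl R u) = cl R (inv_word u) * cl R u * e.
    by apply: idem_comm ee _; rewrite /idempotent_elt mulgA hu'.
  (* By uniqueness of inverses, applied to the product of the class of [u] and [e]. *)
  have -> : cl R (inv_word v) = e * cl R (inv_word u).
    have [t [_ t_uniq]] := inv_pres_inverse (cl R v).
    rewrite -(t_uniq (cl R (inv_word v))) // -(t_uniq (e * cl R (inv_word u))) //.
    rewrite vE; move: hu hu' ee eU {gh}.
    move: (cl R u) (cl R (inv_word u)) => U U' hu hu' ee eU.
    have eU' x : e * (U' * (U * x)) = U' * (U * (e * x)).
      by rewrite !mulgA -(mulgA e) eU.
    have ee' x : e * (e * x) = e * x by rewrite mulgA ee.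
    have UU x : U * (U' * (U * x)) = U * x by rewrite !mulgA hu.
    have UU' : U' * (U * U') = U' by rewrite mulgA.
    split; rewrite -!mulgA; first by rewrite ee' eU' UU ee.
    by rewrite ee' eU' ee' -eU' UU'.
  by rewrite vE -!mulgA [e * (e * _)]mulgA ee eU !mulgA hu.
move: gh hu gv vE; rewrite /=; move: (cl R v) (cl R (inv_word v)) => V V'.
move: (cl R u) (cl R (inv_word u)) => U U' gh hu gv vE.
have gg : V * V' * (V * V') = V * V' by rewrite mulgA gv.
move: (V * V') gg gh vE {gv} => g gg gh vE.
(* The idempotent [g] commutes with [U * U'], so multiplying this conjugate by [U] on the left gives
   [g * U]. *)
exists (U' * g * U).
  rewrite /idempotent_elt -!mulgA (mulgA U U') (mulgA (U * U')) -gh.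
  by rewrite -!mulgA (mulgA U U') hu (mulgA g g) gg.
by rewrite !mulgA -gh -!mulgA (mulgA U U') hu.
Qed.

Lemma schutz_language_ge : language (schutz_automaton R w) =
  [set u : word A | natural_le (cl R w) (cl R u)]%classic.
Proof.
apply/seteqP; split=> u; first by move=> /schutz_language/natural_leE.
by move=> /natural_leE/schutz_language.
Qed.

Lemma schutz_context_free : tree_like (@schutz_adj A R w) ->
  context_free (language (schutz_automaton R w)).
Proof.
pose o : schutz_vertex R w := Sub (cl R (w ++ inv_word w)) (scc_init R w).
pose f : schutz_vertex R w := Sub (cl R w) (scc_final R w).
have detE : deterministic E.
  by move=> x a y z /eqP xy /eqP xz; apply: val_inj; rewrite xy.
have symE : involutive_graph E by move=> x a y; rewrite /E schutz_edge_inv.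
have relE u v : (u, v) \in R -> forall x y, reads E x u y <-> reads E x v y.
  move=> uv x y; rewrite !reads_schutz.
  by have -> : cl R u = cl R v by apply/cl_eqP/CongrGen/RelPres.
(* The collar width [N] is the total length of the finitely many relators. *)
have relN u v : (u, v) \in R ->
    size u + size v <= \sum_(r <- R) (size r.1 + size r.2).
  by move=> uv; rewrite (big_rem _ uv) /= leq_addr.
have eE x y : schutz_adj x y <-> exists a, E x a y.
  by split=> [/existsP|h]; last exact/existsP.
(* The vertex [o] is the class of [w ++ inv_word w], so both prefixed words represent [x]. *)
have initE u v x : reads E o u x -> reads E o v x ->
    congr_closure (relator R) (w ++ inv_word w ++ u) (w ++ inv_word w ++ v).
  move=> /reads_schutz ox /reads_schutz ox'; apply/cl_eqP.
  by rewrite !catA !(cl_cat _ (w ++ _)) -ox.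
have of_ : reads E o w f.
  by apply/reads_schutz; rewrite !SubK cl_cat cl_inv.
have -> : language (schutz_automaton R w) = [set u | reads E o u f]%classic.
  by apply/seteqP; split=> u /lpath_reads.
exact (tree_like_context_free detE symE relE relN eE (schutz_connected (w := w)) initE of_).
Qed.

End SchutzenbergerGraph.

Theorem theorem4p13 (A : finType) (R : seq (word A * word A)) (w : word A) :
  tree_like (@schutz_adj A R w) ->
  language (schutz_automaton R w)
    = [set u : word A | natural_le (cl R w) (cl R u)]%classic
  /\ context_free (language (schutz_automaton R w)).
Proof.
by move=> tlw; split; [exact: schutz_language_ge | exact: schutz_context_free].
Qed.
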